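(* Let $\tau>0$ and let $\gamma:I\to \mathrm{SL}(2,\mathbb{R})_\tau\subset\mathbb{R}^4_2$ be a curve parametrized by arc length, with the direction of the parametrization chosen so that, if the function $g_\tau(\gamma',E_1)$ is constant, this constant is $\ge 0$. Then $\gamma$ is proper biharmonic if and only if there exist a constant $\vartheta\in(0,\pi/2]$ with $$\frac{4(1+\tau^2)}{4+5\tau^2}\le\cos^2\vartheta<1$$ and a smooth function $\beta:I\to\mathbb{R}$ such that $$\gamma'(s)=\cos\vartheta\,E_1+\sin\vartheta\sin\beta(s)\,E_2+\sin\vartheta\cos\beta(s)\,E_3\qquad(s\in I),$$ and such that $\gamma$, as a curve in $\mathbb{R}^4_2$, satisfies $$\gamma^{IV}+(b^2-2a)\,\gamma''+a^2\,\gamma=0,$$ where $a$ and $b$ are the constants given, for a choice of the sign $\pm$, by $$\begin{cases} a=\dfrac12\big(-\tau^{-2}+1-(1+\tau^{-2})\cos2\vartheta\big)-\tau^{-1}\cos\vartheta\,\beta',\\[2mm] b=\beta'=-\tau^{-1}(2+\tau^2)\cos\vartheta\pm\sqrt{(4+5\tau^2)\cos^2\vartheta-4(1+\tau^2)}.\end{cases}$$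
   Context: Let $\mathbb{R}^4_2$ be $\mathbb{R}^4$ with the inner product $\langle v,w\rangle=v_1w_1+v_2w_2-v_3w_3-v_4w_4$; identify $\mathbb{R}^4$ with $\mathbb{C}^2$ via $(z,w)=(x_1+ix_2,x_3+ix_4)$, and identify $\mathrm{SL}(2,\mathbb{R})$ with $\{(z,w)\in\mathbb{C}^2: |z|^2-|w|^2=1\}=\{v\in\mathbb{R}^4_2:\langle v,v\rangle=1\}$. On it consider the tangent vector fields $$X_1(z,w)=(iz,iw),\quad X_2(z,w)=(i\bar w,i\bar z),\quad X_3(z,w)=(\bar w,\bar z).$$ For $\tau>0$, $\mathrm{SL}(2,\mathbb{R})_\tau$ denotes $\mathrm{SL}(2,\mathbb{R})$ with the Riemannian metric $g_\tau(X,Y)=-\langle X,Y\rangle+(1+\tau^2)\langle X,X_1\rangle\langle Y,X_1\rangle$. Then $E_1=-\tau^{-1}X_1$, $E_2=X_2$, $E_3=X_3$ is a global orthonormal frame (evaluated at $\gamma(s)$ in formulas for $\gamma'(s)$). Let $\nabla^\tau$ be the Levi-Civita connection of $g_\tau$ and $R(X,Y)Z=\nabla^\tau_X\nabla^\tau_YZ-\nabla^\tau_Y\nabla^\tau_XZ-\nabla^\tau_{[X,Y]}Z$ its curvature. Curves are smooth and defined on an open interval $I$. A curve $\gamma$ parametrized by arc length, with $T=\gamma'$, is biharmonic if its bitension field vanishes, i.e. $(\nabla^\tau_T)^3T-R(T,\nabla^\tau_TT)T=0$; it is proper biharmonic if it is biharmonic and not a geodesic. In the equation for $\gamma$ as a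 curve in $\mathbb{R}^4_2$, primes denote ordinary derivatives of the $\mathbb{R}^4$-valued function $\gamma(s)$. *)

(* Defs.v *)
From Stdlib Require Export Reals.
From Stdlib Require Import Lra Psatz.
From Coquelicot Require Export Coquelicot.
Open Scope R_scope.

(** * The ambient space R^4_2, identified with C^2 *)

Definition R42 := (C * C)%type.

Definition x1 (v : R42) : R := Re (fst v).
Definition x2 (v : R42) : R := Im (fst v).
Definition x3 (v : R42) : R := Re (snd v).
Definition x4 (v : R42) : R := Im (snd v).

Definition vzero : R42 := zero.
Definition vadd (v w : R42) : R42 := plus v w.
Definition vsub (v w : R42) : R42 := minus v w.
Definition vscal (a : R) (v : R42) : R42 := scal a v.

Infix "+v" := vadd (at level 50, left associativity).
Infix "-v" := vsub (at level 50, left associativity).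
Infix "*v" := vscal (at level 40, left associativity).

Definition ip (v w : R42) : R :=
  x1 v * x1 w + x2 v * x2 w - x3 v * x3 w - x4 v * x4 w.

Definition SL2 (p : R42) : Prop := ip p p = 1.

Definition field := R42 -> R42.

Definition X1 : field := fun p => (Ci * fst p, Ci * snd p)%C.
Definition X2 : field := fun p => (Ci * Cconj (snd p), Ci * Cconj (fst p))%C.
Definition X3 : field := fun p => (Cconj (snd p), Cconj (fst p)).

(** [g tau p] is only meant to be used at [p] in SL2 and on tangent vectors. *)
Definition g (tau : R) (p v w : R42) : R :=
  - ip v w + (1 + tau ^ 2) * ip v (X1 p) * ip w (X1 p).

Definition E1 (tau : R) : field := fun p => (- / tau) *v X1 p.
Definition E2 : field := X2.
Definition E3 : field := X3.

(** * Smooth functions and vector fields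

    SL2 is a closed submanifold of R^4, so its smooth functions and smooth
    vector fields are the restrictions of smooth maps defined on all of R^4.
    Below a vector field on SL2 is given by such an extension, only its values
    on SL2 being relevant; derivatives at points of SL2 in tangent directions,
    and Lie brackets of tangent fields, do not depend on the extension. *)

Definition dir (f : R42 -> R) (p v : R42) : R :=
  Derive (fun t => f (p +v t *v v)) 0.

(** [Ck k f]: [f] is of class C^k on R^4. *)
Fixpoint Ck (k : nat) (f : R42 -> R) : Prop :=
  match k with
  | O => forall p : R42, continuous f p
  | S k' => (forall p : R42, ex_filterdiff (K := R_AbsRing) f (locally p)) /\
            (forall v : R42, Ck k' (fun p => dir f p v))
  end.

Definition smooth (f : R42 -> R) : Prop := forall k, Ck k f.

Definition smooth_map (Y : field) : Prop :=
  smooth (fun p => x1 (Y p)) /\ smooth (fun p => x2 (Y p)) /\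
  smooth (fun p => x3 (Y p)) /\ smooth (fun p => x4 (Y p)).

Definition vector_field (X : field) : Prop :=
  smooth_map X /\ forall p, SL2 p -> ip (X p) p = 0.

Definition dirv (Y : field) (p v : R42) : R42 :=
  ((dir (fun q => x1 (Y q)) p v, dir (fun q => x2 (Y q)) p v),
   (dir (fun q => x3 (Y q)) p v, dir (fun q => x4 (Y q)) p v)).

Definition bracket (X Y : field) : field :=
  fun p => dirv Y p (X p) -v dirv X p (Y p).

(** * The Levi-Civita connection and its curvature *)

Record levi_civita (tau : R) (nabla : field -> field -> field) : Prop := {
  lc_field : forall X Y, vector_field X -> vector_field Y ->
    vector_field (nabla X Y);
  lc_linear : forall (f : R42 -> R) X X' Y,
    smooth f -> vector_field X -> vector_field X' -> vector_field Y ->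
    forall p, SL2 p ->
      nabla (fun q => f q *v X q +v X' q) Y p
      = f p *v nabla X Y p +v nabla X' Y p;
  lc_additive : forall X Y Y',
    vector_field X -> vector_field Y -> vector_field Y' ->
    forall p, SL2 p ->
      nabla X (fun q => Y q +v Y' q) p
      = nabla X Y p +v nabla X Y' p;
  lc_leibniz : forall (f : R42 -> R) X Y,
    smooth f -> vector_field X -> vector_field Y ->
    forall p, SL2 p ->
      nabla X (fun q => f q *v Y q) p
      = dir f p (X p) *v Y p +v f p *v nabla X Y p;
  lc_torsion_free : forall X Y, vector_field X -> vector_field Y ->
    forall p, SL2 p -> nabla X Y p -v nabla Y X p = bracket X Y p;
  lc_metric : forall X Y Z,
    vector_field X -> vector_field Y -> vector_field Z ->
    forall p, SL2 p ->
      dir (fun q => g tau q (Y q) (Z q)) p (X p)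
      = g tau p (nabla X Y p) (Z p) + g tau p (Y p) (nabla X Z p)
}.

Definition curvature_field (nabla : field -> field -> field) (X Y Z : field)
  : field := fun p =>
  nabla X (nabla Y Z) p -v nabla Y (nabla X Z) p -v nabla (bracket X Y) Z p.

(** The field with constant frame coefficients extending the tangent vector
    [v] at [p]. *)
Definition frame_ext (tau : R) (p v : R42) : field := fun q =>
  g tau p v (E1 tau p) *v E1 tau q +v g tau p v (E2 p) *v E2 q
  +v g tau p v (E3 p) *v E3 q.

(** Curvature at tangent vectors [u], [v], [w] at [p]; by tensoriality the
    choice of extensions is immaterial. *)
Definition curvature (tau : R) (nabla : field -> field -> field)
  (p u v w : R42) : R42 :=
  curvature_field nabla (frame_ext tau p u) (frame_ext tau p v)
    (frame_ext tau p w) p.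

(** * Curves *)

(** The open interval with (possibly infinite) endpoints [lo], [hi]. *)
Definition itv (lo hi : Rbar) (s : R) : Prop := Rbar_lt lo s /\ Rbar_lt s hi.

Definition smooth_on (lo hi : Rbar) (f : R -> R) : Prop :=
  forall (n : nat) (s : R), itv lo hi s -> ex_derive_n f n s.

Definition smooth_curve (lo hi : Rbar) (gamma : R -> R42) : Prop :=
  smooth_on lo hi (fun s => x1 (gamma s)) /\
  smooth_on lo hi (fun s => x2 (gamma s)) /\
  smooth_on lo hi (fun s => x3 (gamma s)) /\
  smooth_on lo hi (fun s => x4 (gamma s)).

Definition vDerive_n (gamma : R -> R42) (n : nat) (s : R) : R42 :=
  ((Derive_n (fun t => x1 (gamma t)) n s, Derive_n (fun t => x2 (gamma t)) n s),
   (Derive_n (fun t => x3 (gamma t)) n s, Derive_n (fun t => x4 (gamma t)) n s)).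

Definition velocity (gamma : R -> R42) : R -> R42 := vDerive_n gamma 1.

(** Covariant derivative along [gamma] of a field [V] along [gamma]: writing
    V = sum_i v_i E_i, it is sum_i (v_i' E_i + v_i nabla_(gamma') E_i). *)
Definition cov (tau : R) (nabla : field -> field -> field) (gamma : R -> R42)
  (V : R -> R42) : R -> R42 := fun s =>
  let term (E : field) :=
    Derive (fun t => g tau (gamma t) (V t) (E (gamma t))) s *v E (gamma s)
    +v g tau (gamma s) (V s) (E (gamma s))
       *v nabla (frame_ext tau (gamma s) (velocity gamma s)) E (gamma s)
  in term (E1 tau) +v term E2 +v term E3.

Definition bitension (tau : R) (nabla : field -> field -> field)
  (gamma : R -> R42) (s : R) : R42 :=
  let D := cov tau nabla gamma in
  let T := velocity gamma in
  D (D (D T)) s -v curvature tau nabla (gamma s) (T s) (D T s) (T s).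

Definition biharmonic (tau : R) (nabla : field -> field -> field)
  (lo hi : Rbar) (gamma : R -> R42) : Prop :=
  forall s, itv lo hi s -> bitension tau nabla gamma s = vzero.

Definition geodesic (tau : R) (nabla : field -> field -> field)
  (lo hi : Rbar) (gamma : R -> R42) : Prop :=
  forall s, itv lo hi s -> cov tau nabla gamma (velocity gamma) s = vzero.

Definition proper_biharmonic (tau : R) (nabla : field -> field -> field)
  (lo hi : Rbar) (gamma : R -> R42) : Prop :=
  biharmonic tau nabla lo hi gamma /\ ~ geodesic tau nabla lo hi gamma.

(** * Existence of the Levi-Civita connection

    [levi_civita tau] is inhabited for every [tau > 0]. *)

Module LeviCivitaExistence.

Definition NM := prod_NormedModule R_AbsRing
  (prod_NormedModule R_AbsRing R_NormedModule R_NormedModule)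
  (prod_NormedModule R_AbsRing R_NormedModule R_NormedModule).

Lemma x1_add (p q : R42) : x1 (p +v q) = x1 p + x1 q.
Proof. reflexivity. Qed.
Lemma x2_add (p q : R42) : x2 (p +v q) = x2 p + x2 q.
Proof. reflexivity. Qed.
Lemma x3_add (p q : R42) : x3 (p +v q) = x3 p + x3 q.
Proof. reflexivity. Qed.
Lemma x4_add (p q : R42) : x4 (p +v q) = x4 p + x4 q.
Proof. reflexivity. Qed.
Lemma x1_sub (p q : R42) : x1 (p -v q) = x1 p - x1 q.
Proof. reflexivity. Qed.
Lemma x2_sub (p q : R42) : x2 (p -v q) = x2 p - x2 q.
Proof. reflexivity. Qed.
Lemma x3_sub (p q : R42) : x3 (p -v q) = x3 p - x3 q.
Proof. reflexivity. Qed.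
Lemma x4_sub (p q : R42) : x4 (p -v q) = x4 p - x4 q.
Proof. reflexivity. Qed.
Lemma x1_scal (a : R) (p : R42) : x1 (a *v p) = a * x1 p.
Proof. reflexivity. Qed.
Lemma x2_scal (a : R) (p : R42) : x2 (a *v p) = a * x2 p.
Proof. reflexivity. Qed.
Lemma x3_scal (a : R) (p : R42) : x3 (a *v p) = a * x3 p.
Proof. reflexivity. Qed.
Lemma x4_scal (a : R) (p : R42) : x4 (a *v p) = a * x4 p.
Proof. reflexivity. Qed.

Lemma R42_ext (p q : R42) :
  x1 p = x1 q -> x2 p = x2 q -> x3 p = x3 q -> x4 p = x4 q -> p = q.
Proof.
destruct p as [[a b] [c d]], q as [[e f] [k l]]; unfold x1, x2, x3, x4; simpl.
intros; subst; reflexivity.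
Qed.

Ltac coords := repeat first
  [ rewrite x1_add | rewrite x2_add | rewrite x3_add | rewrite x4_add
  | rewrite x1_sub | rewrite x2_sub | rewrite x3_sub | rewrite x4_sub
  | rewrite x1_scal | rewrite x2_scal | rewrite x3_scal | rewrite x4_scal ].

Lemma at_zero (p v : R42) : p +v 0 *v v = p.
Proof. apply R42_ext; coords; ring. Qed.

Lemma dir_is (f : R42 -> R) (p v : R42) (l : R42 -> R) :
  filterdiff (K := R_AbsRing) f (locally p) l ->
  is_derive (fun t : R => f (p +v t *v v)) 0 (l v).
Proof.
intros Hf.
assert (Hlin : is_linear (K := R_AbsRing) l) by apply Hf.
assert (H1 : filterdiff (K := R_AbsRing)
   (fun t : R => p +v t *v v) (locally (0 : R))
   (fun t : R => t *v v)).
{ eapply filterdiff_ext_lin.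
  - apply (filterdiff_plus_fct (K := R_AbsRing) (fun _ => p) (fun t : R => t *v v)
             (fun _ => zero) (fun t : R => t *v v)).
    + apply filterdiff_const.
    + apply filterdiff_linear. apply (is_linear_scal_l (K := R_AbsRing) (V := NM) v).
  - intros t. apply plus_zero_l. }
unfold is_derive.
eapply filterdiff_ext_lin.
- apply (filterdiff_comp' (K := R_AbsRing) (fun t : R => p +v t *v v) f).
  + exact H1.
  + exact (eq_ind_r (fun q : R42 => filterdiff (K := R_AbsRing) f (locally q) l)
      Hf (at_zero p v)).
- intros t. exact (linear_scal (K := R_AbsRing) l Hlin t v).
Qed.

Lemma dir_eq (f : R42 -> R) (p v : R42) (l : R42 -> R) :
  filterdiff (K := R_AbsRing) f (locally p) l -> dir f p v = l v.
Proof. intros H. apply is_derive_unique. now apply dir_is. Qed.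

Lemma smooth_diff f p :
  smooth f -> ex_filterdiff (K := R_AbsRing) f (locally p).
Proof. intros H. apply (H 1%nat). Qed.

Lemma smooth_dir f v : smooth f -> smooth (fun p => dir f p v).
Proof. intros H k. apply (H (S k)). Qed.

Lemma smooth_filterdiff f p :
  smooth f -> filterdiff (K := R_AbsRing) f (locally p) (dir f p).
Proof.
intros H. destruct (smooth_diff f p H) as [l Hl].
eapply filterdiff_ext_lin; [exact Hl|].
intros v. symmetry. now apply dir_eq.
Qed.

Lemma smooth_ex_derive f p v :
  smooth f -> ex_derive (fun t : R => f (p +v t *v v)) 0.
Proof.
intros H. exists (dir f p v). apply dir_is. now apply smooth_filterdiff.
Qed.

Lemma Ck_ext k : forall f h : R42 -> R, (forall p, f p = h p) -> Ck k f -> Ck k h.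
Proof.
induction k as [|k IH]; intros f h E H.
- intros p. apply (continuous_ext f); auto.
- destruct H as [H1 H2]. split.
  + intros p. apply (ex_filterdiff_ext (K := R_AbsRing) f); auto.
  + intros v. apply (IH (fun p => dir f p v)); auto.
    intros p. apply Derive_ext. intros t. apply E.
Qed.

Lemma smooth_ext (f h : R42 -> R) : (forall p, f p = h p) -> smooth f -> smooth h.
Proof. intros E H k. now apply (Ck_ext k f). Qed.

Lemma dir_ext (f h : R42 -> R) p v : (forall q, f q = h q) -> dir f p v = dir h p v.
Proof. intros E. apply Derive_ext. intros t; apply E. Qed.

Lemma dir_plus f h p v : smooth f -> smooth h ->
  dir (fun q => f q + h q) p v = dir f p v + dir h p v.
Proof. intros. apply Derive_plus; now apply smooth_ex_derive. Qed.

Lemma dir_mult f h p v : smooth f -> smooth h ->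
  dir (fun q => f q * h q) p v = dir f p v * h p + f p * dir h p v.
Proof.
intros. unfold dir. rewrite Derive_mult; try now apply smooth_ex_derive.
now rewrite at_zero.
Qed.

Lemma dir_const c p v : dir (fun _ => c) p v = 0.
Proof. exact (Derive_const c 0). Qed.

Lemma smooth_const c : smooth (fun _ => c).
Proof.
intros k. revert c. induction k; intros c.
- intros p. apply continuous_const.
- split.
  + intros p. exact (ex_filterdiff_const (K := R_AbsRing) (U := NM) (V := R_NormedModule) c).
  + intros v. apply (Ck_ext k (fun _ => 0)); auto.
    intros; symmetry; apply dir_const.
Qed.

Lemma smooth_linear (l : R42 -> R) : is_linear (K := R_AbsRing) l -> smooth l.
Proof.
intros H.
assert (F : forall p, filterdiff (K := R_AbsRing) l (locally p) l)
  by (intros; now apply filterdiff_linear).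
intros [|k].
- intros p. exact (filterdiff_continuous (K := R_AbsRing) (U := NM) (V := R_NormedModule) l p (ex_intro _ l (F p))).
- split.
  + intros p. now exists l.
  + intros v. apply (Ck_ext k (fun _ => l v)); [|apply smooth_const].
    intros p. symmetry. now apply dir_eq.
Qed.

Lemma Ck_plus k : forall f h, Ck k f -> Ck k h -> Ck k (fun q => f q + h q).
Proof.
induction k as [|k IH]; intros f h Hf Hh.
- intros p. apply (continuous_plus (V := R_NormedModule)); auto.
- destruct Hf as [Df Cf], Hh as [Dh Ch]. split.
  + intros p. exact (ex_filterdiff_plus_fct (K := R_AbsRing) (U := NM) (V := R_NormedModule) f h (Df p) (Dh p)).
  + intros v. apply (Ck_ext k (fun p => dir f p v + dir h p v)).
    * intros p. symmetry. destruct (Df p) as [l Hl], (Dh p) as [m Hm].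
      apply Derive_plus; [exists (l v)|exists (m v)]; now apply dir_is.
    * apply IH; auto.
Qed.

Lemma smooth_plus f h : smooth f -> smooth h -> smooth (fun q => f q + h q).
Proof. intros Hf Hh k. now apply Ck_plus. Qed.

Lemma Ck_mult k : forall f h, smooth f -> smooth h -> Ck k (fun q => f q * h q).
Proof.
induction k as [|k IH]; intros f h Sf Sh.
- intros p. apply (continuous_mult (K := R_AbsRing)); [apply (Sf 0%nat)|apply (Sh 0%nat)].
- split.
  + intros p. exact (ex_filterdiff_mult_fct (K := R_AbsRing) (U := NM) f h p Rmult_comm
      (smooth_diff f p Sf) (smooth_diff h p Sh)).
  + intros v. apply (Ck_ext k (fun p => dir f p v * h p + f p * dir h p v)).
    * intros p. symmetry. now apply dir_mult.
    * assert (Sd := smooth_dir).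
      
      apply Ck_plus; apply IH; auto.
Qed.

Lemma smooth_mult f h : smooth f -> smooth h -> smooth (fun q => f q * h q).
Proof. intros Hf Hh k. now apply Ck_mult. Qed.

Lemma smooth_x1 : smooth x1.
Proof. apply smooth_linear, (is_linear_comp (K := R_AbsRing) fst fst); apply (is_linear_fst (K := R_AbsRing)). Qed.
Lemma smooth_x2 : smooth x2.
Proof. apply smooth_linear, (is_linear_comp (K := R_AbsRing) fst snd); [apply (is_linear_fst (K := R_AbsRing))|apply (is_linear_snd (K := R_AbsRing))]. Qed.
Lemma smooth_x3 : smooth x3.
Proof. apply smooth_linear, (is_linear_comp (K := R_AbsRing) snd fst); [apply (is_linear_snd (K := R_AbsRing))|apply (is_linear_fst (K := R_AbsRing))]. Qed.
Lemma smooth_x4 : smooth x4.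
Proof. apply smooth_linear, (is_linear_comp (K := R_AbsRing) snd snd); apply (is_linear_snd (K := R_AbsRing)). Qed.

Lemma smooth_opp f : smooth f -> smooth (fun q => - f q).
Proof.
intros H. apply (smooth_ext (fun q => (-1) * f q)).
intros; ring. apply smooth_mult; auto using smooth_const.
Qed.

Lemma smooth_minus f h : smooth f -> smooth h -> smooth (fun q => f q - h q).
Proof. intros Hf Hh. apply smooth_plus; auto using smooth_opp. Qed.

Lemma dir_opp f p v : dir (fun q => - f q) p v = - dir f p v.
Proof. apply Derive_opp. Qed.

Lemma dir_linear f p (a : R) (v w : R42) : smooth f ->
  dir f p (a *v v +v w) = a * dir f p v + dir f p w.
Proof.
intros H. assert (L : is_linear (K := R_AbsRing) (U := NM) (V := R_NormedModule) (dir f p))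
  by apply (smooth_filterdiff f p H).
etransitivity; [exact (linear_plus _ L (a *v v) w)|].
exact (f_equal (fun z => z + dir f p w) (linear_scal _ L a v)).
Qed.

Lemma dir_lin (l : R42 -> R) p v :
  is_linear (K := R_AbsRing) l -> dir l p v = l v.
Proof. intros H. apply dir_eq. now apply filterdiff_linear. Qed.

Lemma dir_x1 p v : dir x1 p v = x1 v.
Proof. apply dir_lin, (is_linear_comp (K := R_AbsRing) fst fst); apply (is_linear_fst (K := R_AbsRing)). Qed.
Lemma dir_x2 p v : dir x2 p v = x2 v.
Proof. apply dir_lin, (is_linear_comp (K := R_AbsRing) fst snd); [apply (is_linear_fst (K := R_AbsRing))|apply (is_linear_snd (K := R_AbsRing))]. Qed.
Lemma dir_x3 p v : dir x3 p v = x3 v.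
Proof. apply dir_lin, (is_linear_comp (K := R_AbsRing) snd fst); [apply (is_linear_snd (K := R_AbsRing))|apply (is_linear_fst (K := R_AbsRing))]. Qed.
Lemma dir_x4 p v : dir x4 p v = x4 v.
Proof. apply dir_lin, (is_linear_comp (K := R_AbsRing) snd snd); apply (is_linear_snd (K := R_AbsRing)). Qed.

Definition e1 : R42 := ((1, 0), (0, 0)).
Definition e2 : R42 := ((0, 1), (0, 0)).
Definition e3 : R42 := ((0, 0), (1, 0)).
Definition e4 : R42 := ((0, 0), (0, 1)).

Lemma smooth_dir_field f X :
  smooth f -> smooth_map X -> smooth (fun p => dir f p (X p)).
Proof.
intros Sf (S1 & S2 & S3 & S4).
apply (smooth_ext (fun p => x1 (X p) * dir f p e1 + (x2 (X p) * dir f p e2 +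
   (x3 (X p) * dir f p e3 + (x4 (X p) * dir f p e4 + 0))))).
- intros p.
  replace (dir f p (X p)) with (dir f p (x1 (X p) *v e1 +v (x2 (X p) *v e2 +v (x3 (X p) *v e3 +v
    (x4 (X p) *v e4 +v 0 *v e1))))).
  + rewrite !dir_linear; auto. do 4 f_equal.
    assert (L : is_linear (K := R_AbsRing) (U := NM) (V := R_NormedModule) (dir f p))
      by apply (smooth_filterdiff f p Sf).
    symmetry. etransitivity; [|apply (Rmult_0_l (dir f p e1))]. exact (linear_scal _ L 0 e1).
  + f_equal. apply R42_ext; coords; unfold e1, e2, e3, e4, x1, x2, x3, x4, Re, Im; cbn [fst snd]; ring.
- repeat (apply smooth_plus; [apply smooth_mult; auto using smooth_dir|]).
  apply smooth_const.
Qed.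

(** Derivatives at points of SL2 in tangent directions only depend on the
    restriction to SL2. *)
Lemma dir_local f h p v : smooth f -> smooth h ->
  (forall q, SL2 q -> f q = h q) -> SL2 p -> ip v p = 0 -> dir f p v = dir h p v.
Proof.
intros Sf Sh E Hp Hv.
set (n := ip v v).
set (c := fun t : R => / sqrt (1 + t ^ 2 * n) *v (p +v t *v v)).
assert (C0 : c 0 = p).
{ unfold c. replace (1 + 0 ^ 2 * n) with 1 by ring. rewrite sqrt_1, Rinv_1.
  apply R42_ext; coords; ring. }
assert (Hc : filterdiff (K := R_AbsRing) (V := NM) c (locally 0) (fun t : R => t *v v)).
{ assert (Hd : is_derive (fun t : R => / sqrt (1 + t ^ 2 * n)) 0 0).
  { auto_derive; replace (1 + 0 * (0 * 1) * n) with 1 by ring; rewrite sqrt_1;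
      repeat split; try lra; field. }
  assert (Hl : is_derive (V := NM) (fun t : R => p +v t *v v) 0 v).
  { unfold is_derive.
    eapply filterdiff_ext_lin.
    - apply (filterdiff_plus_fct (K := R_AbsRing) (V := NM) (fun _ => p) (fun t : R => t *v v)
             (fun _ => zero) (fun t : R => t *v v)).
      + apply filterdiff_const.
      + apply filterdiff_linear. apply (is_linear_scal_l (K := R_AbsRing) (V := NM) v).
    - intros t. apply plus_zero_l. }
  assert (H := filterdiff_scal_fct (K := R_AbsRing) (U := R_NormedModule) (V := NM) 0
    (fun t : R => / sqrt (1 + t ^ 2 * n)) (fun t : R => p +v t *v v) _ _
    Rmult_comm Hd Hl).
  eapply filterdiff_ext_lin; [exact H|].
  intros t. simpl. replace (1 + 0 * (0 * 1) * n) with 1 by ring.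
  rewrite sqrt_1, Rinv_1.
  change ((t * 0) *v (p +v 0 *v v) +v 1 *v (t *v v) = t *v v).
  apply R42_ext; coords; ring. }
assert (D : forall k, smooth k -> is_derive (fun t : R => k (c t)) 0 (dir k p v)).
{ intros k Sk. unfold is_derive.
  assert (Hk := smooth_filterdiff k p Sk).
  rewrite <- C0 in Hk at 1.
  assert (H := filterdiff_comp' (K := R_AbsRing) (U := R_NormedModule) (V := NM) c k 0 _ _ Hc Hk).
  eapply filterdiff_ext_lin; [exact H|].
  intros t. simpl.
  assert (L : is_linear (K := R_AbsRing) (U := NM) (V := R_NormedModule) (dir k p))
    by apply (smooth_filterdiff k p Sk).
  exact (linear_scal _ L t v). }
assert (D1 := D f Sf). assert (D2 := D h Sh).
rewrite <- (is_derive_unique _ _ _ D1), <- (is_derive_unique _ _ _ D2).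
apply Derive_ext_loc.
assert (P : locally 0 (fun t : R => 0 < 1 + t ^ 2 * n)).
{ assert (Cn : continuous (fun t : R => 1 + t ^ 2 * n) 0).
  { apply (ex_derive_continuous (K := R_AbsRing) (V := R_NormedModule)). auto_derive. auto. }
  apply (Cn (fun y => 0 < y)). apply (open_gt 0). lra. }
revert P. apply filter_imp. intros t Ht. apply E.
unfold SL2, c, ip. coords.
assert (S := sqrt_sqrt _ (Rlt_le _ _ Ht)).
assert (S0 := sqrt_lt_R0 _ Ht).
set (r := sqrt (1 + t ^ 2 * n)) in *.
assert (N : ip (p +v t *v v) (p +v t *v v) = r * r).
{ rewrite S. unfold SL2 in Hp.
  transitivity (ip p p + 2 * t * ip v p + t ^ 2 * n);
    [unfold n, ip; coords; ring|rewrite Hp, Hv; ring]. }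
unfold ip in N. revert N. coords. intros N.
match goal with |- ?L = 1 => match type of N with ?M = _ =>
  transitivity (M / (r * r)); [field; lra|] end end.
rewrite N. field. lra.
Qed.

Lemma SL2_span p v : SL2 p -> ip v p = 0 ->
  v = ip v (X1 p) *v X1 p +v (- ip v (X2 p)) *v X2 p +v (- ip v (X3 p)) *v X3 p.
Proof.
intros Hp Hv.
assert (D : forall a b : R, ip p p * a = b + ip v p * 0 -> a = b)
  by (intros a b; rewrite Hp; lra).
assert (K : forall a b c : R, ip p p * a = b + ip v p * c -> a = b)
  by (intros a b c; rewrite Hp, Hv; lra).
apply R42_ext; coords; [apply K with (x1 p)|apply K with (x2 p)|apply K with (x3 p)|apply K with (x4 p)];
destruct p as [[p1 p2] [p3 p4]], v as [[v1 v2] [v3 v4]];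
unfold ip, X1, X2, X3, x1, x2, x3, x4, Re, Im, Ci, Cconj, Cmult; cbn [fst snd]; ring.
Qed.

Ltac expand := unfold ip, X1, X2, X3, x1, x2, x3, x4, Re, Im, Ci, Cconj, Cmult; cbn [fst snd].

(** Components of a tangent field in the frame E_1, E_2, E_3. *)
Definition y1 tau (Y : field) (q : R42) := - tau * ip (Y q) (X1 q).
Definition y2 (Y : field) (q : R42) := - ip (Y q) (X2 q).
Definition y3 (Y : field) (q : R42) := - ip (Y q) (X3 q).

(** Components of nabla_X Y, from the connection coefficients of the frame:
    nabla_1 E_2 = -(tau + 2/tau) E_3, nabla_1 E_3 = (tau + 2/tau) E_2,
    nabla_2 E_1 = -tau E_3, nabla_2 E_3 = tau E_1,
    nabla_3 E_1 = tau E_2, nabla_3 E_2 = -tau E_1. *)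
Definition c1 tau X Y p := dir (y1 tau Y) p (X p) + tau * y2 X p * y3 Y p - tau * y3 X p * y2 Y p.
Definition c2 tau X Y p := dir (y2 Y) p (X p) + (tau + 2 / tau) * y1 tau X p * y3 Y p + tau * y3 X p * y1 tau Y p.
Definition c3 tau X Y p := dir (y3 Y) p (X p) - (tau + 2 / tau) * y1 tau X p * y2 Y p - tau * y2 X p * y1 tau Y p.

Definition lc tau (X Y : field) : field := fun p =>
  c1 tau X Y p *v E1 tau p +v c2 tau X Y p *v E2 p +v c3 tau X Y p *v E3 p.

Lemma span tau p (Y : field) : 0 < tau -> SL2 p -> ip (Y p) p = 0 ->
  Y p = y1 tau Y p *v E1 tau p +v y2 Y p *v E2 p +v y3 Y p *v E3 p.
Proof.
intros Ht Hp HY. rewrite (SL2_span p (Y p) Hp HY) at 1.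
unfold y1, y2, y3, E1, E2, E3. apply R42_ext; coords; field; lra.
Qed.

Lemma y_comb tau p a b c : 0 < tau -> SL2 p ->
  let V := a *v E1 tau p +v b *v E2 p +v c *v E3 p in
  - tau * ip V (X1 p) = a /\ - ip V (X2 p) = b /\ - ip V (X3 p) = c /\ ip V p = 0.
Proof.
intros Ht Hp V.
assert (K : forall x y : R, x = ip p p * y -> x = y)
  by (intros x y; rewrite Hp; lra).
unfold V, ip, E1, E2, E3; coords.
repeat split; [apply K|apply K|apply K|];
destruct p as [[p1 p2] [p3 p4]]; expand; field; lra.
Qed.

Lemma g_comb tau p v w : SL2 p -> ip v p = 0 -> ip w p = 0 -> 
  g tau p v w = (tau ^ 2) * ip v (X1 p) * ip w (X1 p)
   + ip v (X2 p) * ip w (X2 p) + ip v (X3 p) * ip w (X3 p).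
Proof.
intros Hp Hv Hw. unfold g.
assert (K : ip p p * ip v w = ip v p * ip w p + ip v (X1 p) * ip w (X1 p)
  - ip v (X2 p) * ip w (X2 p) - ip v (X3 p) * ip w (X3 p)).
{ destruct p as [[p1 p2] [p3 p4]], v as [[v1 v2] [v3 v4]], w as [[w1 w2] [w3 w4]];
  expand; ring. }
rewrite Hp, Hv in K. lra.
Qed.

Ltac smt := repeat first [ assumption | apply smooth_plus | apply smooth_minus
  | apply smooth_opp | apply smooth_mult | apply smooth_const
  | apply smooth_x1 | apply smooth_x2 | apply smooth_x3 | apply smooth_x4 ].

Lemma smap_X1 : smooth_map X1.
Proof.
split; [|split; [|split]].
apply (smooth_ext (fun q => - x2 q)); [intros [[? ?] [? ?]]; expand; ring|smt].
apply (smooth_ext (fun q => x1 q)); [intros [[? ?] [? ?]]; expand; ring|smt].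
apply (smooth_ext (fun q => - x4 q)); [intros [[? ?] [? ?]]; expand; ring|smt].
apply (smooth_ext (fun q => x3 q)); [intros [[? ?] [? ?]]; expand; ring|smt].
Qed.
Lemma smap_X2 : smooth_map X2.
Proof.
split; [|split; [|split]].
apply (smooth_ext (fun q => x4 q)); [intros [[? ?] [? ?]]; expand; ring|smt].
apply (smooth_ext (fun q => x3 q)); [intros [[? ?] [? ?]]; expand; ring|smt].
apply (smooth_ext (fun q => x2 q)); [intros [[? ?] [? ?]]; expand; ring|smt].
apply (smooth_ext (fun q => x1 q)); [intros [[? ?] [? ?]]; expand; ring|smt].
Qed.
Lemma smap_X3 : smooth_map X3.
Proof.
split; [|split; [|split]].
apply (smooth_ext (fun q => x3 q)); [intros [[? ?] [? ?]]; expand; ring|smt].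
apply (smooth_ext (fun q => - x4 q)); [intros [[? ?] [? ?]]; expand; ring|smt].
apply (smooth_ext (fun q => x1 q)); [intros [[? ?] [? ?]]; expand; ring|smt].
apply (smooth_ext (fun q => - x2 q)); [intros [[? ?] [? ?]]; expand; ring|smt].
Qed.

Lemma dirv_X1 p v : dirv X1 p v = X1 v.
Proof.
apply R42_ext.
transitivity (dir (fun q => - x2 q) p v); [apply dir_ext; intros [[? ?] [? ?]]; expand; ring|].
rewrite dir_opp, dir_x2; destruct v as [[? ?] [? ?]]; expand; ring.
transitivity (dir x1 p v); [apply dir_ext; intros [[? ?] [? ?]]; expand; ring|].
rewrite dir_x1; destruct v as [[? ?] [? ?]]; expand; ring.
transitivity (dir (fun q => - x4 q) p v); [apply dir_ext; intros [[? ?] [? ?]]; expand; ring|].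
rewrite dir_opp, dir_x4; destruct v as [[? ?] [? ?]]; expand; ring.
transitivity (dir x3 p v); [apply dir_ext; intros [[? ?] [? ?]]; expand; ring|].
rewrite dir_x3; destruct v as [[? ?] [? ?]]; expand; ring.
Qed.
Lemma dirv_X2 p v : dirv X2 p v = X2 v.
Proof.
apply R42_ext.
transitivity (dir x4 p v); [apply dir_ext; intros [[? ?] [? ?]]; expand; ring|].
rewrite dir_x4; destruct v as [[? ?] [? ?]]; expand; ring.
transitivity (dir x3 p v); [apply dir_ext; intros [[? ?] [? ?]]; expand; ring|].
rewrite dir_x3; destruct v as [[? ?] [? ?]]; expand; ring.
transitivity (dir x2 p v); [apply dir_ext; intros [[? ?] [? ?]]; expand; ring|].
rewrite dir_x2; destruct v as [[? ?] [? ?]]; expand; ring.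
transitivity (dir x1 p v); [apply dir_ext; intros [[? ?] [? ?]]; expand; ring|].
rewrite dir_x1; destruct v as [[? ?] [? ?]]; expand; ring.
Qed.
Lemma dirv_X3 p v : dirv X3 p v = X3 v.
Proof.
apply R42_ext.
transitivity (dir x3 p v); [apply dir_ext; intros [[? ?] [? ?]]; expand; ring|].
rewrite dir_x3; destruct v as [[? ?] [? ?]]; expand; ring.
transitivity (dir (fun q => - x4 q) p v); [apply dir_ext; intros [[? ?] [? ?]]; expand; ring|].
rewrite dir_opp, dir_x4; destruct v as [[? ?] [? ?]]; expand; ring.
transitivity (dir x1 p v); [apply dir_ext; intros [[? ?] [? ?]]; expand; ring|].
rewrite dir_x1; destruct v as [[? ?] [? ?]]; expand; ring.
transitivity (dir (fun q => - x2 q) p v); [apply dir_ext; intros [[? ?] [? ?]]; expand; ring|].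
rewrite dir_opp, dir_x2; destruct v as [[? ?] [? ?]]; expand; ring.
Qed.

Lemma smap_id : smooth_map (fun q => q).
Proof. repeat split; smt. Qed.

Lemma smooth_ip Y Z : smooth_map Y -> smooth_map Z -> smooth (fun q => ip (Y q) (Z q)).
Proof. intros (?&?&?&?) (?&?&?&?). unfold ip. smt. Qed.

Lemma dir_ip Y Z p v : smooth_map Y -> smooth_map Z ->
  dir (fun q => ip (Y q) (Z q)) p v = ip (dirv Y p v) (Z p) + ip (Y p) (dirv Z p v).
Proof.
intros (?&?&?&?) (?&?&?&?).
transitivity (dir (fun q => x1 (Y q) * x1 (Z q) + (x2 (Y q) * x2 (Z q) +
   (- (x3 (Y q) * x3 (Z q)) + - (x4 (Y q) * x4 (Z q))))) p v).
apply dir_ext; intros; unfold ip; ring.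
repeat (rewrite dir_plus; [|smt; fail|smt; fail]).
rewrite !dir_opp, !dir_mult; auto.
unfold ip. change (x1 (dirv Y p v)) with (dir (fun q => x1 (Y q)) p v).
change (x2 (dirv Y p v)) with (dir (fun q => x2 (Y q)) p v).
change (x3 (dirv Y p v)) with (dir (fun q => x3 (Y q)) p v).
change (x4 (dirv Y p v)) with (dir (fun q => x4 (Y q)) p v).
change (x1 (dirv Z p v)) with (dir (fun q => x1 (Z q)) p v).
change (x2 (dirv Z p v)) with (dir (fun q => x2 (Z q)) p v).
change (x3 (dirv Z p v)) with (dir (fun q => x3 (Z q)) p v).
change (x4 (dirv Z p v)) with (dir (fun q => x4 (Z q)) p v).
ring.
Qed.

Lemma smooth_y1 tau Y : smooth_map Y -> smooth (y1 tau Y).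
Proof. intros; apply smooth_mult; [apply smooth_const|apply smooth_ip; auto using smap_X1]. Qed.
Lemma smooth_y2 Y : smooth_map Y -> smooth (y2 Y).
Proof. intros; apply smooth_opp; apply smooth_ip; auto using smap_X2. Qed.
Lemma smooth_y3 Y : smooth_map Y -> smooth (y3 Y).
Proof. intros; apply smooth_opp; apply smooth_ip; auto using smap_X3. Qed.

Ltac smc := repeat first [ assumption | apply smooth_y1 | apply smooth_y2 | apply smooth_y3
  | apply smooth_dir_field | apply smooth_const | apply smooth_plus | apply smooth_minus | apply smooth_opp | apply smooth_mult ].

Lemma smooth_c1 tau X Y : smooth_map X -> smooth_map Y -> smooth (c1 tau X Y).
Proof. intros; unfold c1; smc. Qed.
Lemma smooth_c2 tau X Y : smooth_map X -> smooth_map Y -> smooth (c2 tau X Y).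
Proof. intros; unfold c2; smc. Qed.
Lemma smooth_c3 tau X Y : smooth_map X -> smooth_map Y -> smooth (c3 tau X Y).
Proof. intros; unfold c3; smc. Qed.

Lemma smap_add Y Z : smooth_map Y -> smooth_map Z -> smooth_map (fun q => Y q +v Z q).
Proof. intros (?&?&?&?) (?&?&?&?). 
repeat split; [change (smooth (fun q => x1 (Y q) + x1 (Z q)))|
change (smooth (fun q => x2 (Y q) + x2 (Z q)))|
change (smooth (fun q => x3 (Y q) + x3 (Z q)))|
change (smooth (fun q => x4 (Y q) + x4 (Z q)))]; smt. Qed.
Lemma smap_scal f Z : smooth f -> smooth_map Z -> smooth_map (fun q => f q *v Z q).
Proof. intros ? (?&?&?&?). 
repeat split; [change (smooth (fun q => f q * x1 (Z q)))|
change (smooth (fun q => f q * x2 (Z q)))|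
change (smooth (fun q => f q * x3 (Z q)))|
change (smooth (fun q => f q * x4 (Z q)))]; smt. Qed.

Lemma dir_y1 tau Y p v : smooth_map Y ->
  dir (y1 tau Y) p v = - tau * (ip (dirv Y p v) (X1 p) + ip (Y p) (X1 v)).
Proof.
intros H. unfold y1. rewrite dir_mult; [|apply smooth_const|apply smooth_ip; auto using smap_X1].
rewrite dir_const, dir_ip; auto using smap_X1. rewrite dirv_X1. ring.
Qed.
Lemma dir_y2 Y p v : smooth_map Y ->
  dir (y2 Y) p v = - (ip (dirv Y p v) (X2 p) + ip (Y p) (X2 v)).
Proof.
intros H. unfold y2. rewrite dir_opp, dir_ip; auto using smap_X2. now rewrite dirv_X2.
Qed.
Lemma dir_y3 Y p v : smooth_map Y ->
  dir (y3 Y) p v = - (ip (dirv Y p v) (X3 p) + ip (Y p) (X3 v)).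
Proof.
intros H. unfold y3. rewrite dir_opp, dir_ip; auto using smap_X3. now rewrite dirv_X3.
Qed.

Lemma ip_add_l a b c : ip (a +v b) c = ip a c + ip b c.
Proof. unfold ip; coords; ring. Qed.
Lemma ip_sub_l a b c : ip (a -v b) c = ip a c - ip b c.
Proof. unfold ip; coords; ring. Qed.
Lemma ip_scal_l a b c : ip (a *v b) c = a * ip b c.
Proof. unfold ip; coords; ring. Qed.

Lemma lc_tangent tau X Y p : 0 < tau -> SL2 p -> ip (lc tau X Y p) p = 0.
Proof. intros Ht Hp. apply (y_comb tau p _ _ _ Ht Hp). Qed.

Lemma bracket_tangent X Y p : vector_field X -> vector_field Y -> SL2 p ->
  ip (bracket X Y p) p = 0.
Proof.
intros [SX TX] [SY TY] Hp. unfold bracket. rewrite ip_sub_l.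
assert (A : forall U V, smooth_map U -> (forall q, SL2 q -> ip (U q) q = 0) -> 
   ip (V p) p = 0 -> ip (dirv U p (V p)) p = - ip (U p) (V p)).
{ intros U V SU TU HV.
  assert (E := dir_ip U (fun q => q) p (V p) SU smap_id).
  assert (Z : dir (fun q => ip (U q) q) p (V p) = 0).
  { rewrite (dir_local _ (fun _ => 0)); auto using dir_const, smooth_const.
    apply (smooth_ip U (fun q => q)); auto using smap_id. }
  cbv beta in E. rewrite Z in E.
  replace (dirv (fun q => q) p (V p)) with (V p) in E.
  lra.
  apply R42_ext; symmetry; [apply dir_x1|apply dir_x2|apply dir_x3|apply dir_x4]. }
rewrite !A; auto. unfold ip; ring.
Qed.

Lemma levi_civita_lc tau : 0 < tau -> levi_civita tau (lc tau).
Proof.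
intros Ht.
constructor.
- intros X Y [SX TX] [SY TY]. split; [|intros; now apply lc_tangent].
  unfold lc. repeat apply smap_add; apply smap_scal;
    auto using smooth_c1, smooth_c2, smooth_c3, smap_X2, smap_X3.
  apply (smap_scal (fun _ => - / tau)); auto using smooth_const, smap_X1.
- intros f X X' Y Sf [SX TX] [SX' TX'] [SY TY] p Hp.
  unfold lc, c1, c2, c3. rewrite !dir_linear; auto using smooth_y1, smooth_y2, smooth_y3.
  unfold y1 at 2 4, y2 at 1 4, y3.
  apply R42_ext; unfold y1, y2, y3, ip; coords; ring.
- intros X Y Y' [SX TX] [SY TY] [SY' TY'] p Hp.
  assert (A1 : forall v, dir (y1 tau (fun q => Y q +v Y' q)) p v = dir (y1 tau Y) p v + dir (y1 tau Y') p v).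
  { intros v. rewrite <- dir_plus; auto using smooth_y1. apply dir_ext; intros; unfold y1; rewrite ip_add_l; ring. }
  assert (A2 : forall v, dir (y2 (fun q => Y q +v Y' q)) p v = dir (y2 Y) p v + dir (y2 Y') p v).
  { intros v. rewrite <- dir_plus; auto using smooth_y2. apply dir_ext; intros; unfold y2; rewrite ip_add_l; ring. }
  assert (A3 : forall v, dir (y3 (fun q => Y q +v Y' q)) p v = dir (y3 Y) p v + dir (y3 Y') p v).
  { intros v. rewrite <- dir_plus; auto using smooth_y3. apply dir_ext; intros; unfold y3; rewrite ip_add_l; ring. }
  unfold lc, c1, c2, c3. rewrite A1, A2, A3.
  apply R42_ext; unfold y1, y2, y3; rewrite ?ip_add_l; coords; ring.
- intros f X Y Sf [SX TX] [SY TY] p Hp.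
  assert (A1 : forall v, dir (y1 tau (fun q => f q *v Y q)) p v = dir f p v * y1 tau Y p + f p * dir (y1 tau Y) p v).
  { intros v. rewrite <- dir_mult; auto using smooth_y1. apply dir_ext; intros; unfold y1; rewrite ip_scal_l; ring. }
  assert (A2 : forall v, dir (y2 (fun q => f q *v Y q)) p v = dir f p v * y2 Y p + f p * dir (y2 Y) p v).
  { intros v. rewrite <- dir_mult; auto using smooth_y2. apply dir_ext; intros; unfold y2; rewrite ip_scal_l; ring. }
  assert (A3 : forall v, dir (y3 (fun q => f q *v Y q)) p v = dir f p v * y3 Y p + f p * dir (y3 Y) p v).
  { intros v. rewrite <- dir_mult; auto using smooth_y3. apply dir_ext; intros; unfold y3; rewrite ip_scal_l; ring. }
  unfold lc, c1, c2, c3. rewrite A1, A2, A3.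
  rewrite (span tau p Y Ht Hp (TY p Hp)) at 1.
  apply R42_ext; unfold y1, y2, y3; rewrite ?ip_scal_l; coords; ring.
- intros X Y VX VY p Hp.
  assert (HW := bracket_tangent X Y p VX VY Hp).
  destruct VX as [SX TX], VY as [SY TY].
  rewrite (span tau p (bracket X Y) Ht Hp HW).
  assert (EX := span tau p X Ht Hp (TX p Hp)).
  assert (EY := span tau p Y Ht Hp (TY p Hp)).
  unfold lc.
  assert (K : forall x y z : R, x - y = ip p p * z -> x - y = z)
    by (intros x y z; rewrite Hp; lra).
  assert (B1 : c1 tau X Y p - c1 tau Y X p = y1 tau (bracket X Y) p).
  { unfold c1. rewrite !dir_y1; auto. unfold bracket, y1 at 1. rewrite ip_sub_l.
    set (a := y1 tau X p) in *. set (b := y2 X p) in *. set (c := y3 X p) in *.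
    set (a' := y1 tau Y p) in *. set (b' := y2 Y p) in *. set (c' := y3 Y p) in *.
    assert (Q : tau * (ip (Y p) (X1 (X p)) - ip (X p) (X1 (Y p))) = 2 * (b * c' - c * b') * tau * ip p p).
    { rewrite EX, EY. unfold E1, E2, E3. generalize a b c a' b' c'; intros.
      destruct p as [[p1 p2] [p3 p4]]. unfold ip; coords. expand. 
      unfold vadd, vscal, plus, scal; cbn. field. lra. }
    rewrite Hp in Q. lra. }
  assert (B2 : c2 tau X Y p - c2 tau Y X p = y2 (bracket X Y) p).
  { unfold c2. rewrite !dir_y2; auto. unfold bracket, y2 at 1. rewrite ip_sub_l.
    set (a := y1 tau X p) in *. set (b := y2 X p) in *. set (c := y3 X p) in *.
    set (a' := y1 tau Y p) in *. set (b' := y2 Y p) in *. set (c' := y3 Y p) in *.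
    assert (Q : ip (Y p) (X2 (X p)) - ip (X p) (X2 (Y p)) = 2 / tau * (a * c' - c * a') * ip p p).
    { rewrite EX, EY. unfold E1, E2, E3. generalize a b c a' b' c'; intros.
      destruct p as [[p1 p2] [p3 p4]]. unfold ip; coords. expand. 
      unfold vadd, vscal, plus, scal; cbn. field. lra. }
    rewrite Hp in Q. lra. }
  assert (B3 : c3 tau X Y p - c3 tau Y X p = y3 (bracket X Y) p).
  { unfold c3. rewrite !dir_y3; auto. unfold bracket, y3 at 1. rewrite ip_sub_l.
    set (a := y1 tau X p) in *. set (b := y2 X p) in *. set (c := y3 X p) in *.
    set (a' := y1 tau Y p) in *. set (b' := y2 Y p) in *. set (c' := y3 Y p) in *.
    assert (Q : ip (Y p) (X3 (X p)) - ip (X p) (X3 (Y p)) = - (2 / tau) * (a * b' - b * a') * ip p p).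
    { rewrite EX, EY. unfold E1, E2, E3. generalize a b c a' b' c'; intros.
      destruct p as [[p1 p2] [p3 p4]]. unfold ip; coords. expand. 
      unfold vadd, vscal, plus, scal; cbn. field. lra. }
    rewrite Hp in Q. lra. }
  rewrite <- B1, <- B2, <- B3. apply R42_ext; coords; ring.
- intros X Y Z [SX TX] [SY TY] [SZ TZ] p Hp.
  assert (G : forall q, SL2 q -> g tau q (Y q) (Z q) =
     y1 tau Y q * y1 tau Z q + (y2 Y q * y2 Z q + y3 Y q * y3 Z q)).
  { intros q Hq. rewrite g_comb; auto. unfold y1, y2, y3. ring. }
  assert (SG : smooth (fun q => g tau q (Y q) (Z q))).
  { unfold g. apply smooth_plus; [apply smooth_opp; now apply smooth_ip|].
    apply smooth_mult; [apply smooth_mult; [apply smooth_const|]|];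
    apply smooth_ip; auto using smap_X1. }
  assert (S1 := smooth_y1). assert (S2 := smooth_y2). assert (S3 := smooth_y3).
  rewrite (dir_local _ (fun q => y1 tau Y q * y1 tau Z q + (y2 Y q * y2 Z q + y3 Y q * y3 Z q)));
    [|exact SG|smc|exact G|exact Hp|auto].
  rewrite !dir_plus; [|smc..]. rewrite !dir_mult; auto.
  rewrite !g_comb; auto using lc_tangent.
  destruct (y_comb tau p (c1 tau X Y p) (c2 tau X Y p) (c3 tau X Y p) Ht Hp) as (U1&U2&U3&_).
  destruct (y_comb tau p (c1 tau X Z p) (c2 tau X Z p) (c3 tau X Z p) Ht Hp) as (V1&V2&V3&_).
  fold (lc tau X Y p) in U1, U2, U3. fold (lc tau X Z p) in V1, V2, V3.
  transitivity (c1 tau X Y p * y1 tau Z p + c2 tau X Y p * y2 Z p + c3 tau X Y p * y3 Z p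
   + (c1 tau X Z p * y1 tau Y p + c2 tau X Z p * y2 Y p + c3 tau X Z p * y3 Y p)).
  + unfold c1, c2, c3. ring.
  + rewrite <- U1, <- U2, <- U3, <- V1, <- V2, <- V3. unfold y1, y2, y3. ring.
Qed.

End LeviCivitaExistence.

Theorem levi_civita_exists (tau : R) :
  0 < tau -> exists nabla, levi_civita tau nabla.
Proof.
intros Ht. exists (LeviCivitaExistence.lc tau).
now apply LeviCivitaExistence.levi_civita_lc.
Qed.

(* Main.v *)
Require Import Defs.
From Stdlib Require Import Arith Lra Lia.
Import LeviCivitaExistence.

(** Everything is expressed in the global frame E_1, E_2, E_3.  Its connection
    coefficients are constant, so the covariant derivative of a field along the
    curve becomes v' + N(T, v) on coefficient functions with values in R^3 and
    the curvature becomes a fixed trilinear map; a Levi-Civita connection is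
    determined by metricity and torsion-freeness, hence the given one has these
    coefficients ([levi_civita_unique], [nabla_frame], [bitension_frame]).
    In an orthonormal frame the curvature is
    R(u, v) w = 4 (1 + tau^2) (u x v)_1 (e_1 x w) - tau^2 (u x v) x w.

    The heart of the matter is that the angle between T and E_1 is constant
    along a proper biharmonic curve ([biharmonic3_constant_angle]).  Put
    A = D T and U = T x A.  The component along T of the biharmonic equation
    says that k = |A|^2 is constant; let w be the torsion, so that
    D A = - k T + w U and D U = - w A.  The other two components read
      k (k + w^2) = tau^2 k - 4 (1 + tau^2) U_1^2,
      k w' = - 4 (1 + tau^2) U_1 A_1,
    while T_1' = A_1 and U_1' = (tau - w) A_1.  Differentiating the first
    equation and inserting the others gives U_1 A_1 (2 w - tau) = 0, so that
    (2 w - tau)^2 is constant; hence w' = 0 and U_1 A_1 = 0, and then U_1^2 is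
    constant.  If U_1 does not vanish, A_1 = 0.  If U_1 = 0, then w = tau would
    force k = 0, so again A_1 = 0.

    With T_1 = c = cos theta constant and s = sin theta > 0, A is a multiple
    lambda s of the unit normal to T orthogonal to E_1, with lambda constant because
    k is.  Thus (T_2, T_3) rotates at a constant speed
    b = lambda - 2 (tau + 1 / tau) c, and in the rotating frame the covariant
    derivative has constant coefficients: such a helix is a geodesic iff
    lambda = 0, and biharmonic iff lambda = 0 or
      lambda^2 - 2 tau c lambda + 4 (1 + tau^2) s^2 = 0
    ([helix_geodesic], [helix_biharmonic]).  The roots of this quadratic
    equation give the two values of b, and the nonnegativity of its
    discriminant is the lower bound on cos^2 theta.

    The equation in R^4 holds along every helix: since X_1^2 = -1 and X_1
    anticommutes with X_2 and X_3, one finds gamma'' = a gamma + b X_1 gamma',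
    and applying this twice eliminates X_1 ([twisted_system_second_order],
    [fourth_order_ode]). *)

(** * Coefficient vectors and the Levi-Civita connection in the frame *)

Record vec := Vec { v1 : R; v2 : R; v3 : R }.

Definition add3 (u v : vec) : vec := Vec (v1 u + v1 v) (v2 u + v2 v) (v3 u + v3 v).
Definition scal3 (a : R) (u : vec) : vec := Vec (a * v1 u) (a * v2 u) (a * v3 u).
Definition sub3 (u v : vec) : vec := Vec (v1 u - v1 v) (v2 u - v2 v) (v3 u - v3 v).
Definition dot (u v : vec) : R := v1 u * v1 v + v2 u * v2 v + v3 u * v3 v.
Definition cross (u v : vec) : vec :=
  Vec (v2 u * v3 v - v3 u * v2 v) (v3 u * v1 v - v1 u * v3 v)
      (v1 u * v2 v - v2 u * v1 v).

(** Coefficients of nabla_(frame u) (frame v) for constant [u] and [v]. *)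
Definition conn (tau : R) (u v : vec) : vec :=
  Vec (tau * v2 u * v3 v - tau * v3 u * v2 v)
      ((tau + 2 / tau) * v1 u * v3 v + tau * v3 u * v1 v)
      (- (tau + 2 / tau) * v1 u * v2 v - tau * v2 u * v1 v).

(** The curvature of the bilinear product [conn], in which [u . v - v . u]
    plays the part of the Lie bracket. *)
Definition riem (tau : R) (u v w : vec) : vec :=
  sub3 (sub3 (conn tau u (conn tau v w)) (conn tau v (conn tau u w)))
       (conn tau (sub3 (conn tau u v) (conn tau v u)) w).

Definition frame (tau : R) (u : vec) : field := fun q =>
  v1 u *v E1 tau q +v v2 u *v E2 q +v v3 u *v E3 q.

Definition coord (tau : R) (p v : R42) : vec :=
  Vec (g tau p v (E1 tau p)) (g tau p v (E2 p)) (g tau p v (E3 p)).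

Lemma vec_ext (u v : vec) : v1 u = v1 v -> v2 u = v2 v -> v3 u = v3 v -> u = v.
Proof. destruct u, v; cbn; congruence. Qed.

Ltac vec_unfold := unfold riem, conn, cross, dot, add3, scal3, sub3; cbn [v1 v2 v3].
Ltac vec_ring := apply vec_ext; vec_unfold; ring.

Lemma dot_self_zero (u : vec) : dot u u = 0 -> u = Vec 0 0 0.
Proof. destruct u; vec_unfold; intros H; f_equal; nra. Qed.

Lemma cross_of_cross (u v w : vec) :
  cross (cross u v) w = sub3 (scal3 (dot u w) v) (scal3 (dot v w) u).
Proof. vec_ring. Qed.

Lemma lagrange_identity (u v : vec) :
  dot (cross u v) (cross u v) = dot u u * dot v v - dot u v ^ 2.
Proof. vec_unfold; ring. Qed.

(** The curvature operator is diagonal in the frame: [tau ^ 2] on the planes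
    containing E_1, [- 3 tau ^ 2 - 4] on its orthogonal complement. *)
Lemma riem_eq (tau : R) (u v w : vec) : 0 < tau ->
  riem tau u v w =
  sub3 (scal3 (4 * (1 + tau ^ 2) * v1 (cross u v)) (cross (Vec 1 0 0) w))
       (scal3 (tau ^ 2) (cross (cross u v) w)).
Proof. intros Ht. apply vec_ext; vec_unfold; field; lra. Qed.

Lemma frame_coeffs (tau : R) (p : R42) (u : vec) : 0 < tau -> SL2 p ->
  - tau * ip (frame tau u p) (X1 p) = v1 u /\ - ip (frame tau u p) (X2 p) = v2 u /\
  - ip (frame tau u p) (X3 p) = v3 u /\ ip (frame tau u p) p = 0.
Proof. intros Ht Hp. exact (y_comb tau p (v1 u) (v2 u) (v3 u) Ht Hp). Qed.

Lemma coord_eq (tau : R) (p v : R42) : 0 < tau -> SL2 p ->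
  coord tau p v = Vec (- tau * ip v (X1 p)) (- ip v (X2 p)) (- ip v (X3 p)).
Proof.
intros Ht Hp.
assert (K : forall x y z : R, x = ip p p * y + z -> x = y + z)
  by (intros x y z; rewrite Hp; lra).
unfold coord, g, E1, E2, E3. apply vec_ext; cbn [v1 v2 v3].
- rewrite <- (Rplus_0_l (- tau * _)), Rplus_comm.
  transitivity (/ tau * (ip v (X1 p)) * (1 - (1 + tau ^ 2) * ip p p)).
  + destruct p as [[p1 p2] [p3 p4]]. unfold ip; coords; expand; ring.
  + rewrite Hp. field. lra.
- destruct p as [[p1 p2] [p3 p4]]. expand; ring.
- destruct p as [[p1 p2] [p3 p4]]. expand; ring.
Qed.

Lemma coord_frame (tau : R) (p : R42) (u : vec) : 0 < tau -> SL2 p ->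
  coord tau p (frame tau u p) = u.
Proof.
intros Ht Hp. rewrite coord_eq by assumption.
destruct (frame_coeffs tau p u Ht Hp) as (-> & -> & -> & _). now destruct u.
Qed.

Lemma frame_coord (tau : R) (p v : R42) : 0 < tau -> SL2 p -> ip v p = 0 ->
  frame tau (coord tau p v) p = v.
Proof.
intros Ht Hp Hv. rewrite coord_eq by assumption. symmetry.
exact (span tau p (fun _ => v) Ht Hp Hv).
Qed.

Lemma frame_eq_zero (tau : R) (p : R42) (u : vec) : 0 < tau -> SL2 p ->
  frame tau u p = vzero <-> u = Vec 0 0 0.
Proof.
intros Ht Hp. split.
- intros H. rewrite <- (coord_frame tau p u Ht Hp), H, coord_eq by assumption.
  unfold vzero. apply vec_ext; cbn [v1 v2 v3]; unfold ip, x1, x2, x3, x4; cbn; ring.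
- intros ->. apply R42_ext; unfold frame; coords; cbn; ring.
Qed.

Lemma frame_sub (tau : R) (p : R42) (u v : vec) :
  frame tau u p -v frame tau v p = frame tau (sub3 u v) p.
Proof. unfold frame. apply R42_ext; coords; cbn; ring. Qed.

Lemma vector_field_E1 (tau : R) : 0 < tau -> vector_field (E1 tau).
Proof.
intros Ht; split.
- apply (smap_scal (fun _ => - / tau)); auto using smooth_const, smap_X1.
- intros [[p1 p2] [p3 p4]] _. unfold E1, ip; coords; expand; ring.
Qed.
Lemma vector_field_E2 : vector_field E2.
Proof.
split; [exact smap_X2|]. intros [[p1 p2] [p3 p4]] _. unfold E2; expand; ring.
Qed.
Lemma vector_field_E3 : vector_field E3.
Proof.
split; [exact smap_X3|]. intros [[p1 p2] [p3 p4]] _. unfold E3; expand; ring.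
Qed.

Lemma vector_field_frame (tau : R) (u : vec) : 0 < tau -> vector_field (frame tau u).
Proof.
intros Ht. split.
- unfold frame. repeat apply smap_add;
    apply (smap_scal (fun _ => _)); auto using smooth_const, smap_X2, smap_X3.
  apply (vector_field_E1 tau Ht).
- intros p Hp. apply (frame_coeffs tau p u Ht Hp).
Qed.

(** Needed to apply the axioms of the connection to the term nabla_[X, Y] of
    the curvature. *)
Lemma vector_field_bracket (X Y : field) :
  vector_field X -> vector_field Y -> vector_field (bracket X Y).
Proof.
intros VX VY. split; [|intros; now apply bracket_tangent].
destruct VX as [SX _], VY as [SY _].
assert (D : forall U V, smooth_map U -> smooth_map V -> smooth_map (fun p => dirv U p (V p))).
{ intros U V (U1 & U2 & U3 & U4) SV.
  repeat split; unfold dirv, x1, x2, x3, x4; cbn; apply smooth_dir_field; assumption. }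
destruct (D Y X SY SX) as (A1 & A2 & A3 & A4).
destruct (D X Y SX SY) as (B1 & B2 & B3 & B4).
repeat split.
- exact (smooth_minus _ _ A1 B1).
- exact (smooth_minus _ _ A2 B2).
- exact (smooth_minus _ _ A3 B3).
- exact (smooth_minus _ _ A4 B4).
Qed.

Lemma g_sym (tau : R) (p v w : R42) : g tau p v w = g tau p w v.
Proof. unfold g, ip. ring. Qed.

Lemma g_sub_l (tau : R) (p u v w : R42) : g tau p (u -v v) w = g tau p u w - g tau p v w.
Proof. unfold g. rewrite !ip_sub_l. ring. Qed.

(** The difference d of the two connections, lowered with the metric, is
    symmetric in its first two arguments and skew in its last two; a trilinear
    form with both properties vanishes.  Pairing with the frame then suffices. *)
Lemma levi_civita_unique (tau : R) (n1 n2 : field -> field -> field) (X Y : field) (p : R42) :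
  0 < tau -> levi_civita tau n1 -> levi_civita tau n2 ->
  vector_field X -> vector_field Y -> SL2 p -> n1 X Y p = n2 X Y p.
Proof.
intros Ht L1 L2 VX VY Hp.
set (d := fun X Y Z : field => g tau p (n1 X Y p) (Z p) - g tau p (n2 X Y p) (Z p)).
assert (sym : forall X Y Z, vector_field X -> vector_field Y -> d X Y Z = d Y X Z).
{ intros A B Z VA VB. unfold d.
  assert (H1 := lc_torsion_free _ _ L1 A B VA VB p Hp).
  assert (H2 := lc_torsion_free _ _ L2 A B VA VB p Hp).
  rewrite <- H2 in H1. apply (f_equal (fun v => g tau p v (Z p))) in H1.
  rewrite !g_sub_l in H1. lra. }
assert (skew : forall X Y Z, vector_field X -> vector_field Y -> vector_field Z ->
  d X Y Z = - d X Z Y).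
{ intros A B Z VA VB VZ. unfold d.
  assert (H1 := lc_metric _ _ L1 A B Z VA VB VZ p Hp).
  assert (H2 := lc_metric _ _ L2 A B Z VA VB VZ p Hp).
  rewrite (g_sym tau p (B p)) in H1, H2. lra. }
assert (zero : forall Z, vector_field Z -> g tau p (n1 X Y p) (Z p) = g tau p (n2 X Y p) (Z p)).
{ intros Z VZ. enough (d X Y Z = 0) by (unfold d in *; lra).
  assert (d X Y Z = - d X Y Z); [|lra].
  rewrite (skew X Y Z) at 1 by assumption.
  rewrite (sym X Z Y), (skew Z X Y), (sym Z Y X), (skew Y Z X), (sym Y X Z)
    by assumption. ring. }
rewrite <- (frame_coord tau p (n1 X Y p)), <- (frame_coord tau p (n2 X Y p)); try assumption.
- f_equal. unfold coord.
  now rewrite (zero _ (vector_field_E1 tau Ht)), (zero _ vector_field_E2), (zero _ vector_field_E3).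
- now apply (lc_field _ _ L2 X Y VX VY).
- now apply (lc_field _ _ L1 X Y VX VY).
Qed.

(** Two relaxations make this applicable to nested derivatives: [Y] need only
    agree with a constant combination of the frame on SL2, since derivatives in
    tangent directions see nothing else, and [X] only at the point [p]. *)
Lemma nabla_frame (tau : R) (nabla : field -> field -> field) (X Y : field) (u v : vec) (p : R42) :
  0 < tau -> levi_civita tau nabla -> vector_field X -> vector_field Y -> SL2 p ->
  X p = frame tau u p -> (forall q, SL2 q -> Y q = frame tau v q) ->
  nabla X Y p = frame tau (conn tau u v) p.
Proof.
intros Ht L VX VY Hp HX HY.
rewrite (levi_civita_unique tau nabla (lc tau) X Y p Ht L (levi_civita_lc tau Ht) VX VY Hp).
assert (SY := proj1 VY).
assert (flat : forall f c, smooth f -> (forall q, SL2 q -> f q = c) -> dir f p (X p) = 0).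
{ intros f c Sf E. rewrite (dir_local f (fun _ => c)); auto using dir_const, smooth_const.
  apply VX, Hp. }
assert (C : forall Z w q, SL2 q -> Z q = frame tau w q ->
  y1 tau Z q = v1 w /\ y2 Z q = v2 w /\ y3 Z q = v3 w).
{ intros Z w q Hq E. unfold y1, y2, y3. rewrite E.
  destruct (frame_coeffs tau q w Ht Hq) as (? & ? & ? & _). auto. }
destruct (C X u p Hp HX) as (P1 & P2 & P3).
destruct (C Y v p Hp (HY p Hp)) as (Q1 & Q2 & Q3).
unfold lc, frame, c1, c2, c3. rewrite P1, P2, P3, Q1, Q2, Q3.
rewrite (flat (y1 tau Y) (v1 v)), (flat (y2 Y) (v2 v)), (flat (y3 Y) (v3 v)); auto
  using smooth_y1, smooth_y2, smooth_y3;
  try (intros q Hq; now apply (C Y v q Hq (HY q Hq))).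
apply R42_ext; coords; unfold conn; cbn [v1 v2 v3]; ring.
Qed.

Lemma curvature_coord (tau : R) (nabla : field -> field -> field) (p x y z : R42) :
  0 < tau -> levi_civita tau nabla -> SL2 p ->
  curvature tau nabla p x y z =
  frame tau (riem tau (coord tau p x) (coord tau p y) (coord tau p z)) p.
Proof.
intros Ht L Hp.
change (curvature_field nabla (frame tau (coord tau p x)) (frame tau (coord tau p y))
  (frame tau (coord tau p z)) p
  = frame tau (riem tau (coord tau p x) (coord tau p y) (coord tau p z)) p).
generalize (coord tau p x) (coord tau p y) (coord tau p z); intros u v w.
assert (VF := fun a => vector_field_frame tau a Ht).
assert (N : forall a b q, SL2 q ->
  nabla (frame tau a) (frame tau b) q = frame tau (conn tau a b) q)
  by (intros; apply nabla_frame; auto).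
assert (NN : forall a b c,
  nabla (frame tau a) (nabla (frame tau b) (frame tau c)) p
  = frame tau (conn tau a (conn tau b c)) p).
{ intros a b c. apply nabla_frame; auto. now apply (lc_field _ _ L). }
unfold curvature_field, riem. rewrite !NN.
rewrite (nabla_frame tau nabla (bracket (frame tau u) (frame tau v)) (frame tau w)
  (sub3 (conn tau u v) (conn tau v u)) w p); auto.
- now rewrite !frame_sub.
- now apply vector_field_bracket.
- rewrite <- (lc_torsion_free _ _ L) by auto. now rewrite !N, frame_sub.
Qed.

(** * Calculus of coefficient functions on an interval *)

Lemma itv_locally (lo hi : Rbar) (s : R) : itv lo hi s -> locally s (itv lo hi).
Proof.
intros [Hl Hh]. apply filter_and.
- now apply (open_Rbar_gt lo).
- now apply (open_Rbar_lt hi).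
Qed.

Lemma itv_between (lo hi : Rbar) (a b t : R) :
  itv lo hi a -> itv lo hi b -> a <= t <= b -> itv lo hi t.
Proof.
intros [Ha _] [_ Hb] [H1 H2]. split.
- now apply (Rbar_lt_le_trans lo a t).
- now apply (Rbar_le_lt_trans t b hi).
Qed.

Lemma itv_inhabited (lo hi : Rbar) : Rbar_lt lo hi -> exists s, itv lo hi s.
Proof.
unfold itv. destruct lo as [l| |], hi as [h| |]; cbn; intros H; try easy.
- exists ((l + h) / 2). cbn; lra.
- exists (l + 1). cbn; lra.
- exists (h - 1). cbn; lra.
- now exists 0.
Qed.

Lemma constant_on_itv (lo hi : Rbar) (f : R -> R) :
  (forall s, itv lo hi s -> is_derive f s 0) ->
  forall a b, itv lo hi a -> itv lo hi b -> f a = f b.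
Proof.
intros H.
assert (K : forall a b, itv lo hi a -> itv lo hi b -> a < b -> f a = f b).
{ intros a b Ha Hb Hab. apply (eq_is_derive f); auto.
  intros t Ht. apply H. now apply (itv_between lo hi a b). }
intros a b Ha Hb. destruct (Rtotal_order a b) as [L|[E|G]].
- auto.
- now subst.
- symmetry; auto.
Qed.

Lemma is_derive_on_itv (lo hi : Rbar) (f h : R -> R) (s l : R) :
  (forall t, itv lo hi t -> f t = h t) -> itv lo hi s -> is_derive f s l -> is_derive h s l.
Proof.
intros E Hs. apply is_derive_ext_loc.
generalize (itv_locally lo hi s Hs). now apply filter_imp.
Qed.

Lemma Derive_ext_itv (lo hi : Rbar) (f h : R -> R) (s : R) :
  (forall t, itv lo hi t -> f t = h t) -> itv lo hi s -> Derive f s = Derive h s.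
Proof.
intros E Hs. apply Derive_ext_loc.
generalize (itv_locally lo hi s Hs). now apply filter_imp.
Qed.

Lemma smooth_on_ext (lo hi : Rbar) (f h : R -> R) :
  (forall t, itv lo hi t -> f t = h t) -> smooth_on lo hi f -> smooth_on lo hi h.
Proof.
intros E H n s Hs. apply (ex_derive_n_ext_loc f); auto.
generalize (itv_locally lo hi s Hs). now apply filter_imp.
Qed.

Lemma smooth_on_ex_derive (lo hi : Rbar) (f : R -> R) (s : R) :
  smooth_on lo hi f -> itv lo hi s -> ex_derive f s.
Proof. intros H. exact (H 1%nat s). Qed.

Lemma Derive_n_Derive (f : R -> R) (n : nat) (s : R) :
  Derive_n (Derive f) n s = Derive_n f (S n) s.
Proof.
change (Derive_n (Derive_n f 1) n s = Derive_n f (S n) s).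
rewrite Derive_n_comp. f_equal. lia.
Qed.

Lemma smooth_on_Derive (lo hi : Rbar) (f : R -> R) :
  smooth_on lo hi f -> smooth_on lo hi (Derive f).
Proof.
intros H [|n] s Hs; [exact I|].
apply (ex_derive_ext (Derive_n f (S n))).
- intros t. symmetry. apply Derive_n_Derive.
- exact (H (S (S n)) s Hs).
Qed.

Lemma smooth_on_const (lo hi : Rbar) (c : R) : smooth_on lo hi (fun _ => c).
Proof. intros n s _. apply ex_derive_n_const. Qed.

Lemma smooth_on_plus (lo hi : Rbar) (f h : R -> R) :
  smooth_on lo hi f -> smooth_on lo hi h -> smooth_on lo hi (fun t => f t + h t).
Proof.
intros Hf Hh n s Hs.
apply ex_derive_n_plus; generalize (itv_locally lo hi s Hs); apply filter_imp; auto.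
Qed.

Lemma smooth_on_opp (lo hi : Rbar) (f : R -> R) :
  smooth_on lo hi f -> smooth_on lo hi (fun t => - f t).
Proof. intros Hf n s Hs. apply ex_derive_n_opp. auto. Qed.

Lemma smooth_on_minus (lo hi : Rbar) (f h : R -> R) :
  smooth_on lo hi f -> smooth_on lo hi h -> smooth_on lo hi (fun t => f t - h t).
Proof. intros. apply smooth_on_plus; auto using smooth_on_opp. Qed.

(** Strong induction on the order of differentiation, over all pairs of
    functions: (f h)' is a sum of products of smooth functions again. *)
Lemma smooth_on_mult (lo hi : Rbar) (f h : R -> R) :
  smooth_on lo hi f -> smooth_on lo hi h -> smooth_on lo hi (fun t => f t * h t).
Proof.
intros Hf Hh n. revert f h Hf Hh.
induction n as [n IH] using lt_wf_ind; intros f h Hf Hh s Hs.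
destruct n as [|[|n]]; [exact I| |].
- apply ex_derive_mult; now apply (smooth_on_ex_derive lo hi).
- apply (ex_derive_ext (Derive_n (Derive (fun x => f x * h x)) n)).
  + intros t. apply Derive_n_Derive.
  + change (ex_derive_n (Derive (fun x => f x * h x)) (S n) s).
    apply (ex_derive_n_ext_loc (fun t => Derive f t * h t + f t * Derive h t)).
    * generalize (itv_locally lo hi s Hs). apply filter_imp.
      intros t It. symmetry. apply Derive_mult; now apply (smooth_on_ex_derive lo hi).
    * apply ex_derive_n_plus; generalize (itv_locally lo hi s Hs); apply filter_imp;
        intros t It k Hk; apply IH; auto using smooth_on_Derive; lia.
Qed.

Definition smooth3 (lo hi : Rbar) (v : R -> vec) : Prop :=
  smooth_on lo hi (fun t => v1 (v t)) /\ smooth_on lo hi (fun t => v2 (v t)) /\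
  smooth_on lo hi (fun t => v3 (v t)).

Definition ddt (v : R -> vec) (s : R) : vec :=
  Vec (Derive (fun t => v1 (v t)) s) (Derive (fun t => v2 (v t)) s)
      (Derive (fun t => v3 (v t)) s).

(** The covariant derivative along a curve with velocity coefficients [T]. *)
Definition cov3 (tau : R) (T v : R -> vec) (s : R) : vec :=
  add3 (ddt v s) (conn tau (T s) (v s)).

(* Matching on the shape of the function keeps unification from unfolding
   [smooth_on]. *)
Ltac smooth_on_tac := repeat match goal with
  | H : ?P |- ?P => exact H
  | |- smooth_on _ _ (fun t => @?f t + @?h t) => apply (smooth_on_plus _ _ f h)
  | |- smooth_on _ _ (fun t => @?f t - @?h t) => apply (smooth_on_minus _ _ f h)
  | |- smooth_on _ _ (fun t => @?f t * @?h t) => apply (smooth_on_mult _ _ f h)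
  | |- smooth_on _ _ (fun t => - @?f t) => apply (smooth_on_opp _ _ f)
  | |- smooth_on _ _ (fun t => Derive ?f t) => apply (smooth_on_Derive _ _ f)
  | |- smooth_on _ _ (fun _ => ?c) => apply (smooth_on_const _ _ c)
  end.

Lemma smooth_dot (lo hi : Rbar) (v w : R -> vec) :
  smooth3 lo hi v -> smooth3 lo hi w -> smooth_on lo hi (fun t => dot (v t) (w t)).
Proof. intros (? & ? & ?) (? & ? & ?). unfold dot. smooth_on_tac. Qed.

Lemma smooth_cross (lo hi : Rbar) (v w : R -> vec) :
  smooth3 lo hi v -> smooth3 lo hi w -> smooth3 lo hi (fun t => cross (v t) (w t)).
Proof. intros (? & ? & ?) (? & ? & ?). repeat split; cbn; smooth_on_tac. Qed.

Lemma smooth_cov3 (lo hi : Rbar) (tau : R) (T v : R -> vec) :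
  smooth3 lo hi T -> smooth3 lo hi v -> smooth3 lo hi (cov3 tau T v).
Proof. intros (? & ? & ?) (? & ? & ?). repeat split; cbn; smooth_on_tac. Qed.

Lemma cov3_ext (lo hi : Rbar) (tau : R) (T v w : R -> vec) (s : R) :
  (forall t, itv lo hi t -> v t = w t) -> itv lo hi s -> cov3 tau T v s = cov3 tau T w s.
Proof.
intros E Hs. unfold cov3. rewrite (E s Hs). f_equal.
apply vec_ext; cbn; apply (Derive_ext_itv lo hi); auto; intros t Ht; now rewrite E.
Qed.

Ltac ex_derive_tac := match goal with Hs : itv _ _ ?s |- ex_derive _ ?s =>
  apply (fun K => smooth_on_ex_derive _ _ _ _ K Hs); smooth_on_tac end.

Lemma is_derive_v1 (lo hi : Rbar) (tau : R) (T v : R -> vec) (s : R) :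
  smooth3 lo hi v -> itv lo hi s ->
  is_derive (fun t => v1 (v t)) s (v1 (cov3 tau T v s) - v1 (conn tau (T s) (v s))).
Proof.
intros (? & ? & ?) Hs.
replace (_ - _) with (Derive (fun t => v1 (v t)) s) by (unfold cov3; vec_unfold; cbn; ring).
apply Derive_correct. ex_derive_tac.
Qed.

(** Metricity: [conn] is skew in its second argument, so its contributions
    cancel. *)
Lemma is_derive_dot (lo hi : Rbar) (tau : R) (T v w : R -> vec) (s : R) :
  smooth3 lo hi v -> smooth3 lo hi w -> itv lo hi s ->
  is_derive (fun t => dot (v t) (w t)) s
    (dot (cov3 tau T v s) (w s) + dot (v s) (cov3 tau T w s)).
Proof.
intros (? & ? & ?) (? & ? & ?) Hs.
replace (_ + _) with (Derive (fun t => dot (v t) (w t)) s).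
- apply Derive_correct. unfold dot. ex_derive_tac.
- unfold cov3, ddt; vec_unfold.
  rewrite !Derive_plus, !Derive_mult by ex_derive_tac. ring.
Qed.

(** [conn] is skew in its second argument, hence acts on R^3 by infinitesimal
    rotations, which are derivations of the cross product. *)
Lemma cov3_cross (lo hi : Rbar) (tau : R) (T v w : R -> vec) (s : R) :
  smooth3 lo hi v -> smooth3 lo hi w -> itv lo hi s ->
  cov3 tau T (fun t => cross (v t) (w t)) s
  = add3 (cross (cov3 tau T v s) (w s)) (cross (v s) (cov3 tau T w s)).
Proof.
intros (? & ? & ?) (? & ? & ?) Hs.
unfold cov3, ddt. apply vec_ext; vec_unfold;
rewrite Derive_minus, !Derive_mult by ex_derive_tac; ring.
Qed.

Lemma cov3_add (lo hi : Rbar) (tau : R) (T v w : R -> vec) (s : R) :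
  smooth3 lo hi v -> smooth3 lo hi w -> itv lo hi s ->
  cov3 tau T (fun t => add3 (v t) (w t)) s = add3 (cov3 tau T v s) (cov3 tau T w s).
Proof.
intros (? & ? & ?) (? & ? & ?) Hs.
unfold cov3, ddt. apply vec_ext; vec_unfold; rewrite Derive_plus by ex_derive_tac; ring.
Qed.

Lemma cov3_scal (lo hi : Rbar) (tau : R) (T v : R -> vec) (f : R -> R) (s : R) :
  smooth_on lo hi f -> smooth3 lo hi v -> itv lo hi s ->
  cov3 tau T (fun t => scal3 (f t) (v t)) s
  = add3 (scal3 (Derive f s) (v s)) (scal3 (f s) (cov3 tau T v s)).
Proof.
intros ? (? & ? & ?) Hs.
unfold cov3, ddt. apply vec_ext; vec_unfold; rewrite Derive_mult by ex_derive_tac; ring.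
Qed.

(** * The angle of a proper biharmonic curve with E_1 *)

Definition biharmonic3 (tau : R) (lo hi : Rbar) (T : R -> vec) : Prop :=
  forall s, itv lo hi s ->
    cov3 tau T (cov3 tau T (cov3 tau T T)) s = riem tau (T s) (cov3 tau T T s) (T s).

Definition geodesic3 (tau : R) (lo hi : Rbar) (T : R -> vec) : Prop :=
  forall s, itv lo hi s -> cov3 tau T T s = Vec 0 0 0.

Lemma is_derive_const_on (lo hi : Rbar) (f : R -> R) (c s l : R) :
  (forall t, itv lo hi t -> f t = c) -> itv lo hi s -> is_derive f s l -> l = 0.
Proof.
intros E Hs H. rewrite <- (is_derive_unique f s l H).
rewrite (Derive_ext_itv lo hi f (fun _ => c) s E Hs). apply Derive_const.
Qed.

(** T, A and T x A are orthogonal and span R^3, so the components of J along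
    them determine it.  The difference Y of the two sides is orthogonal to all
    three; as (T x A) x Y = 0 as well, Lagrange's identity yields Y = 0. *)
Lemma frenet_expansion (T A J : vec) (k : R) : 0 < k ->
  dot T T = 1 -> dot T A = 0 -> dot A A = k -> dot J T = - k -> dot J A = 0 ->
  J = add3 (scal3 (- k) T) (scal3 (/ k * dot J (cross T A)) (cross T A)).
Proof.
intros Hk HT HTA HA HJT HJA.
set (U := cross T A).
assert (HU : dot U U = k) by (unfold U; rewrite lagrange_identity, HT, HA, HTA; ring).
assert (HTU : dot T U = 0) by (unfold U; vec_unfold; ring).
assert (HAU : dot A U = 0) by (unfold U; vec_unfold; ring).
set (w := / k * dot J U).
set (Y := sub3 J (add3 (scal3 (- k) T) (scal3 w U))).
assert (lin : forall Z, dot Z Y = dot J Z + k * dot T Z - w * dot Z U)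
  by (intros; unfold Y; vec_unfold; ring).
assert (YT : dot T Y = 0) by (rewrite lin, HJT, HT, HTU; ring).
assert (YA : dot A Y = 0) by (rewrite lin, HJA, HTA, HAU; ring).
assert (YU : dot U Y = 0).
{ rewrite lin, HU, HTU. unfold w. field. lra. }
assert (cr : cross U Y = Vec 0 0 0)
  by (unfold U; rewrite cross_of_cross, YT, YA; vec_ring).
assert (L := lagrange_identity U Y). rewrite cr, YU, HU in L.
assert (Z : Y = Vec 0 0 0).
{ apply dot_self_zero. apply (Rmult_eq_reg_l k); [|lra].
  unfold dot in L at 1; cbn in L. lra. }
unfold Y in Z. apply vec_ext.
- apply (f_equal v1) in Z. cbn in Z |- *. lra.
- apply (f_equal v2) in Z. cbn in Z |- *. lra.
- apply (f_equal v3) in Z. cbn in Z |- *. lra.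
Qed.

(** The right-hand side of the biharmonic equation in the basis
    T, A, T x A. *)
Lemma riem_frenet (tau : R) (T A : vec) : 0 < tau -> dot T T = 1 -> dot T A = 0 ->
  dot (riem tau T A T) T = 0 /\
  dot (riem tau T A T) A
    = 4 * (1 + tau ^ 2) * v1 (cross T A) ^ 2 - tau ^ 2 * dot A A /\
  dot (riem tau T A T) (cross T A) = - 4 * (1 + tau ^ 2) * v1 (cross T A) * v1 A.
Proof.
intros Ht HT HTA. rewrite riem_eq, cross_of_cross by assumption.
assert (lin : forall a b X Y Z, dot (sub3 (scal3 a X) (scal3 b Y)) Z = a * dot X Z - b * dot Y Z)
  by (intros; vec_unfold; ring).
assert (HAT : dot A T = 0) by (rewrite <- HTA; vec_unfold; ring).
rewrite !lin, HAT, HT, HTA.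
assert (Q1 : dot (cross (Vec 1 0 0) T) T = 0) by (vec_unfold; ring).
assert (Q2 : dot (cross (Vec 1 0 0) T) A = v1 (cross T A)) by (vec_unfold; ring).
assert (Q3 : dot (cross (Vec 1 0 0) T) (cross T A) = v1 T * dot T A - v1 A * dot T T)
  by (vec_unfold; ring).
assert (Q4 : dot A (cross T A) = 0) by (vec_unfold; ring).
assert (Q5 : dot T (cross T A) = 0) by (vec_unfold; ring).
rewrite Q1, Q2, Q3, Q4, Q5, HT, HTA. repeat split; ring.
Qed.

(** The first curvature is constant: the curvature term is orthogonal to T,
    and differentiating <D A, T> = - <A, A> shows that the component of
    D (D A) along T is - 3 <D A, A>.  The constant is nonzero since the curve
    is not a geodesic. *)
Lemma biharmonic3_curvature (tau : R) (lo hi : Rbar) (T : R -> vec) (s0 : R) :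
  0 < tau -> smooth3 lo hi T -> (forall s, itv lo hi s -> dot (T s) (T s) = 1) ->
  biharmonic3 tau lo hi T -> itv lo hi s0 -> ~ geodesic3 tau lo hi T ->
  exists k, 0 < k /\ forall s, itv lo hi s ->
    dot (T s) (cov3 tau T T s) = 0 /\
    dot (cov3 tau T T s) (cov3 tau T T s) = k /\
    dot (cov3 tau T (cov3 tau T T) s) (T s) = - k /\
    dot (cov3 tau T (cov3 tau T T) s) (cov3 tau T T s) = 0.
Proof.
intros Ht ST unit bih Hs0 ngeo.
set (A := cov3 tau T T). set (J := cov3 tau T A).
change (forall s, itv lo hi s -> cov3 tau T J s = riem tau (T s) (A s) (T s)) in bih.
assert (SA : smooth3 lo hi A) by now apply smooth_cov3.
assert (SJ : smooth3 lo hi J) by now apply smooth_cov3.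
assert (comm : forall u v, dot u v = dot v u) by (intros; vec_unfold; ring).
assert (TA : forall s, itv lo hi s -> dot (T s) (A s) = 0).
{ intros s Hs.
  assert (H := is_derive_const_on lo hi _ 1 s _ unit Hs (is_derive_dot lo hi tau T T T s ST ST Hs)).
  fold A in H. rewrite (comm (A s)) in H. lra. }
assert (JT : forall s, itv lo hi s -> dot (J s) (T s) + dot (A s) (A s) = 0).
{ intros s Hs.
  assert (H := is_derive_const_on lo hi _ 0 s _ TA Hs (is_derive_dot lo hi tau T T A s ST SA Hs)).
  fold A J in H. rewrite (comm (T s)) in H. lra. }
assert (JA : forall s, itv lo hi s -> dot (J s) (A s) = 0).
{ intros s Hs.
  assert (D1 := is_derive_dot lo hi tau T J T s SJ ST Hs).
  assert (D2 := is_derive_dot lo hi tau T A A s SA SA Hs).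
  assert (H := is_derive_const_on lo hi _ 0 s _ JT Hs (is_derive_plus _ _ s _ _ D1 D2)).
  unfold plus in H; cbn in H.
  change (cov3 tau T T s) with (A s) in H. change (cov3 tau T A s) with (J s) in H.
  rewrite (bih s Hs) in H.
  rewrite (proj1 (riem_frenet tau (T s) (A s) Ht (unit s Hs) (TA s Hs))), (comm (A s) (J s)) in H.
  lra. }
assert (AA : forall s, itv lo hi s -> dot (A s) (A s) = dot (A s0) (A s0)).
{ intros s Hs. apply (constant_on_itv lo hi (fun t => dot (A t) (A t))); auto.
  intros t It. assert (D := is_derive_dot lo hi tau T A A t SA SA It).
  fold J in D. rewrite (comm (A t) (J t)), JA, Rplus_0_r in D by assumption. exact D. }
exists (dot (A s0) (A s0)). split.
- assert (N : 0 <= dot (A s0) (A s0)) by (vec_unfold; nra).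
  destruct (Rle_lt_or_eq_dec _ _ N) as [|Z]; [assumption|].
  exfalso. apply ngeo. intros s Hs. apply dot_self_zero. fold A.
  now rewrite AA.
- intros s Hs. repeat split; auto.
  rewrite <- (AA s Hs). assert (H := JT s Hs). lra.
Qed.

(** For [u] = U_1 and [w] the torsion, this is the derivative of the component
    of the biharmonic equation along A. *)
Lemma is_derive_quadratic (u w : R -> R) (a b k s u' w' : R) :
  is_derive u s u' -> is_derive w s w' ->
  is_derive (fun t => (k + w t ^ 2) * k - (a - b * u t ^ 2)) s
    (2 * k * w s * w' + 2 * b * u s * u').
Proof.
intros Hu Hw.
assert (ex_derive u s) by now exists u'.
assert (ex_derive w s) by now exists w'.
auto_derive; [auto|].
assert (Eu : Derive (fun x : R => u x) s = u') by exact (is_derive_unique u s u' Hu).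
assert (Ew : Derive (fun x : R => w x) s = w') by exact (is_derive_unique w s w' Hw).
rewrite Eu, Ew. ring.
Qed.

Lemma is_derive_square (w : R -> R) (a s w' : R) : is_derive w s w' ->
  is_derive (fun t => (2 * w t - a) ^ 2) s (4 * (2 * w s - a) * w').
Proof.
intros Hw. assert (ex_derive w s) by now exists w'.
assert (Ew : Derive (fun x : R => w x) s = w') by exact (is_derive_unique w s w' Hw).
auto_derive; [auto|]. rewrite Ew. ring.
Qed.

(** Everything is reduced to the four scalar relations [eqA], [eqU], [dU1] and
    T_1' = A_1.  They force [w] to be constant, and the only case in which
    A_1 could fail to vanish, namely U_1 = 0 and w = tau, contradicts
    [eqA]. *)
Lemma biharmonic3_constant_angle (tau : R) (lo hi : Rbar) (T : R -> vec) (s0 : R) :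
  0 < tau -> smooth3 lo hi T -> (forall s, itv lo hi s -> dot (T s) (T s) = 1) ->
  biharmonic3 tau lo hi T -> itv lo hi s0 -> ~ geodesic3 tau lo hi T ->
  forall s, itv lo hi s -> v1 (cov3 tau T T s) = 0.
Proof.
intros Ht ST unit bih Hs0 ngeo.
destruct (biharmonic3_curvature tau lo hi T s0) as (k & Hk & frenet); auto.
set (A := cov3 tau T T) in *. set (J := cov3 tau T A) in *.
change (forall s, itv lo hi s -> cov3 tau T J s = riem tau (T s) (A s) (T s)) in bih.
set (U := fun t => cross (T t) (A t)).
set (w := fun t => / k * dot (J t) (U t)).
assert (SA : smooth3 lo hi A) by now apply smooth_cov3.
assert (SJ : smooth3 lo hi J) by now apply smooth_cov3.
assert (SU : smooth3 lo hi U) by now apply smooth_cross.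
assert (Sw : smooth_on lo hi w).
{ apply smooth_on_mult; [apply smooth_on_const|now apply smooth_dot]. }
assert (Jexp : forall s, itv lo hi s -> J s = add3 (scal3 (- k) (T s)) (scal3 (w s) (U s))).
{ intros s Hs. destruct (frenet s Hs) as (H1 & H2 & H3 & H4).
  apply frenet_expansion; auto. }
assert (TU : forall s, itv lo hi s -> cross (T s) (U s) = scal3 (- 1) (A s)).
{ intros s Hs. destruct (frenet s Hs) as (H1 & _).
  transitivity (sub3 (scal3 (dot (T s) (A s)) (T s)) (scal3 (dot (T s) (T s)) (A s)));
    [unfold U; vec_ring|]. rewrite H1, unit by assumption. vec_ring. }
assert (DU : forall s, itv lo hi s -> cov3 tau T U s = scal3 (- w s) (A s)).
{ intros s Hs. unfold U at 1. rewrite (cov3_cross lo hi) by assumption. fold A J.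
  rewrite Jexp by assumption.
  transitivity (scal3 (w s) (cross (T s) (U s))); [vec_ring|].
  rewrite TU by assumption. vec_ring. }
assert (DJ : forall s, itv lo hi s -> cov3 tau T J s
  = add3 (scal3 (- k - w s ^ 2) (A s)) (scal3 (Derive w s) (U s))).
{ intros s Hs.
  assert (S1 : smooth3 lo hi (fun t => scal3 (- k) (T t))).
  { destruct ST as (? & ? & ?). repeat split; cbn; smooth_on_tac. }
  assert (S2 : smooth3 lo hi (fun t => scal3 (w t) (U t))).
  { destruct SU as (? & ? & ?). repeat split; unfold scal3; cbn [v1 v2 v3]; smooth_on_tac. }
  rewrite (cov3_ext lo hi tau T J _ s Jexp Hs), (cov3_add lo hi) by assumption.
  rewrite (cov3_scal lo hi tau T T (fun _ => - k)) by auto using smooth_on_const.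
  rewrite (cov3_scal lo hi tau T U w), DU, Derive_const by assumption.
  fold A. vec_ring. }
assert (UU : forall s, itv lo hi s -> dot (U s) (U s) = k).
{ intros s Hs. destruct (frenet s Hs) as (H1 & H2 & _).
  unfold U. rewrite lagrange_identity, H1, H2, unit by assumption. ring. }
assert (AU : forall s, dot (A s) (U s) = 0) by (intros; unfold U; vec_unfold; ring).
assert (lin : forall a b X Y Z, dot (add3 (scal3 a X) (scal3 b Y)) Z = a * dot X Z + b * dot Y Z)
  by (intros; vec_unfold; ring).
assert (eqA : forall s, itv lo hi s ->
  (k + w s ^ 2) * k = tau ^ 2 * k - 4 * (1 + tau ^ 2) * v1 (U s) ^ 2).
{ intros s Hs. destruct (frenet s Hs) as (H1 & H2 & _).
  destruct (riem_frenet tau (T s) (A s) Ht (unit s Hs) H1) as (_ & R & _).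
  rewrite <- (bih s Hs), DJ, lin, H2 in R by assumption.
  replace (dot (U s) (A s)) with (dot (A s) (U s)) in R by (vec_unfold; ring).
  rewrite AU in R. fold (U s) in R. lra. }
assert (eqU : forall s, itv lo hi s ->
  Derive w s * k = - 4 * (1 + tau ^ 2) * (v1 (U s) * v1 (A s))).
{ intros s Hs. destruct (frenet s Hs) as (H1 & H2 & _).
  destruct (riem_frenet tau (T s) (A s) Ht (unit s Hs) H1) as (_ & _ & R).
  rewrite <- (bih s Hs), DJ, lin in R by assumption.
  change (cross (T s) (A s)) with (U s) in R. rewrite AU, UU in R by assumption. lra. }
assert (dU1 : forall s, itv lo hi s -> is_derive (fun t => v1 (U t)) s ((tau - w s) * v1 (A s))).
{ intros s Hs. assert (D := is_derive_v1 lo hi tau T U s SU Hs).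
  rewrite DU in D by assumption.
  assert (E : v2 (T s) * v3 (U s) - v3 (T s) * v2 (U s) = - 1 * v1 (A s))
    by exact (f_equal v1 (TU s Hs)).
  replace ((tau - w s) * v1 (A s))
    with (v1 (scal3 (- w s) (A s)) - v1 (conn tau (T s) (U s))); [exact D|].
  unfold conn, scal3; cbn [v1].
  transitivity (- w s * v1 (A s) - tau * (v2 (T s) * v3 (U s) - v3 (T s) * v2 (U s))); [ring|].
  rewrite E. ring. }
assert (dw : forall s, itv lo hi s -> is_derive w s (Derive w s))
  by (intros; apply Derive_correct; now apply (smooth_on_ex_derive lo hi)).
assert (prod : forall s, itv lo hi s -> v1 (U s) * v1 (A s) * (2 * w s - tau) = 0).
{ intros s Hs. assert (dU := dU1 s Hs). assert (dW := dw s Hs).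
  assert (Z := is_derive_quadratic (fun t => v1 (U t)) w (tau ^ 2 * k)
    (4 * (1 + tau ^ 2)) k s _ _ dU dW).
  apply (is_derive_const_on lo hi _ 0) in Z; auto.
  - assert (W := eqU s Hs).
    apply (Rmult_eq_reg_l (- 8 * (1 + tau ^ 2))); [|nra].
    rewrite Rmult_0_r, <- Z.
    transitivity (2 * w s * (- 4 * (1 + tau ^ 2) * (v1 (U s) * v1 (A s)))
      + 2 * (4 * (1 + tau ^ 2)) * v1 (U s) * ((tau - w s) * v1 (A s))); [ring|].
    rewrite <- W. ring.
  - intros t It. rewrite (eqA t It). ring. }
(* The relation [prod] leaves open which factor vanishes where; constancy of
   (2 w - tau)^2 makes the alternative uniform on the interval. *)
assert (dphi : forall s, itv lo hi s -> is_derive (fun t => (2 * w t - tau) ^ 2) s 0).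
{ intros s Hs.
  replace 0 with (4 * (2 * w s - tau) * Derive w s).
  - apply is_derive_square. auto.
  - apply (Rmult_eq_reg_r k); [|lra].
    transitivity (4 * (2 * w s - tau) * (Derive w s * k)); [ring|].
    rewrite eqU by assumption.
    transitivity (- 16 * (1 + tau ^ 2) * (v1 (U s) * v1 (A s) * (2 * w s - tau))); [ring|].
    rewrite prod by assumption. ring. }
assert (dw0 : forall s, itv lo hi s -> Derive w s = 0).
{ destruct (Req_dec (2 * w s0 - tau) 0) as [E|E]; intros s Hs.
  - apply (is_derive_const_on lo hi w (tau / 2) s); auto.
    intros t It. assert (Q := constant_on_itv lo hi _ dphi t s0 It Hs0).
    cbv beta in Q. rewrite E in Q. nra.
  - assert (Q := constant_on_itv lo hi _ dphi s s0 Hs Hs0). cbv beta in Q.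
    assert (P := prod s Hs). apply Rmult_integral in P as [P|P].
    + assert (W := eqU s Hs). rewrite P in W.
      apply (Rmult_eq_reg_r k); lra.
    + rewrite P in Q. exfalso. apply E. nra. }
assert (UA : forall s, itv lo hi s -> v1 (U s) * v1 (A s) = 0).
{ intros s Hs. assert (W := eqU s Hs). rewrite dw0 in W by assumption.
  apply (Rmult_eq_reg_l (- 4 * (1 + tau ^ 2))); nra. }
assert (wc : forall s, itv lo hi s -> w s = w s0).
{ intros s Hs. apply (constant_on_itv lo hi w); auto.
  intros t It. rewrite <- (dw0 t It). auto. }
assert (Uc : forall s, itv lo hi s -> v1 (U s) ^ 2 = v1 (U s0) ^ 2).
{ intros s Hs. assert (Q := eqA s Hs). rewrite wc, (eqA s0 Hs0) in Q by assumption.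
  apply (Rmult_eq_reg_l (4 * (1 + tau ^ 2))); nra. }
intros s Hs.
destruct (Req_dec (v1 (U s0)) 0) as [E|E].
- assert (Z : (tau - w s) * v1 (A s) = 0).
  { apply (is_derive_const_on lo hi (fun t => v1 (U t)) 0 s); auto.
    intros t It. assert (Q := Uc t It). rewrite E in Q. nra. }
  apply Rmult_integral in Z as [Z|Z]; [|exact Z].
  exfalso. assert (Q := eqA s Hs). assert (Q0 := Uc s Hs). rewrite Q0, E in Q.
  replace (w s) with tau in Q by lra. nra.
- assert (P := UA s Hs). apply Rmult_integral in P as [P|P]; [|exact P].
  exfalso. assert (Q := Uc s Hs). rewrite P in Q. apply E. nra.
Qed.

(** * Helices *)

(** The vector p e_1 + q n + r m, where n = (0, sin beta, cos beta) and
    m = (0, cos beta, - sin beta). *)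
Definition rotating (beta p q r : R) : vec :=
  Vec p (q * sin beta + r * cos beta) (q * cos beta - r * sin beta).

Lemma rotating_inj (beta p q r p' q' r' : R) :
  rotating beta p q r = rotating beta p' q' r' -> p = p' /\ q = q' /\ r = r'.
Proof.
unfold rotating. intros [= E1 E2 E3].
assert (S := sin2_cos2 beta). unfold Rsqr in S.
set (x := sin beta) in *. set (y := cos beta) in *.
assert (F2 : (q - q') * x + (r - r') * y = 0) by lra.
assert (F3 : (q - q') * y - (r - r') * x = 0) by lra.
repeat split; [exact E1| |]; apply Rminus_diag_uniq.
- transitivity (((q - q') * x + (r - r') * y) * x + ((q - q') * y - (r - r') * x) * y).
  + rewrite <- (Rmult_1_r (q - q')) at 1. rewrite <- S. ring.
  + rewrite F2, F3. ring.
- transitivity (((q - q') * x + (r - r') * y) * y - ((q - q') * y - (r - r') * x) * x).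
  + rewrite <- (Rmult_1_r (r - r')) at 1. rewrite <- S. ring.
  + rewrite F2, F3. ring.
Qed.

(** n' = b m and m' = - b n, so along a helix the covariant derivative is a
    constant skew matrix in the rotating frame. *)
Lemma cov3_rotating (lo hi : Rbar) (tau : R) (T v : R -> vec) (beta : R -> R)
  (b c sg p q r s : R) :
  T s = rotating (beta s) c sg 0 -> (forall t, itv lo hi t -> v t = rotating (beta t) p q r) ->
  itv lo hi s -> is_derive beta s b ->
  cov3 tau T v s = rotating (beta s) (- tau * sg * r) (- (b + (tau + 2 / tau) * c) * r)
    ((b + (tau + 2 / tau) * c) * q + tau * sg * p).
Proof.
intros HT Hv Hs Hb.
rewrite (cov3_ext lo hi tau T v _ s Hv Hs). unfold cov3. rewrite HT.
assert (D : ddt (fun t => rotating (beta t) p q r) s = rotating (beta s) 0 (- b * r) (b * q)).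
{ assert (ex_derive beta s) by now exists b.
  assert (Eb : Derive (fun x : R => beta x) s = b) by exact (is_derive_unique beta s b Hb).
  unfold ddt, rotating; cbn [v1 v2 v3]. apply vec_ext; cbn [v1 v2 v3];
    apply is_derive_unique; auto_derive; auto; rewrite ?Eb; ring. }
rewrite D.
assert (S := sin2_cos2 (beta s)). unfold Rsqr in S.
unfold rotating. apply vec_ext; vec_unfold.
- transitivity (- tau * sg * r * (sin (beta s) * sin (beta s) + cos (beta s) * cos (beta s)));
    [ring|rewrite S; ring].
- ring.
- ring.
Qed.

Section Helix.
Context (lo hi : Rbar) (tau : R) (T : R -> vec) (beta : R -> R) (b c sg : R)
  (tau_pos : 0 < tau) (sg_pos : 0 < sg) (unit : c ^ 2 + sg ^ 2 = 1)
  (helix : forall t, itv lo hi t -> T t = rotating (beta t) c sg 0)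
  (beta_slope : forall t, itv lo hi t -> is_derive beta t b).

(* The acceleration is [sg * lam] times m; [lam] differs from the rotation
   speed by the contribution of the connection. *)
Let lam := b + 2 * (tau + / tau) * c.

Lemma helix_acceleration (s : R) : itv lo hi s ->
  cov3 tau T T s = rotating (beta s) 0 0 (sg * lam).
Proof.
intros Hs. rewrite (cov3_rotating lo hi tau T T beta b c sg c sg 0 s); auto.
unfold lam. f_equal; try ring. field. lra.
Qed.

Lemma helix_geodesic (s : R) : itv lo hi s ->
  cov3 tau T T s = Vec 0 0 0 <-> lam = 0.
Proof.
intros Hs. rewrite helix_acceleration by assumption.
replace (Vec 0 0 0) with (rotating (beta s) 0 0 0) by (unfold rotating; f_equal; ring).
split.
- intros (_ & _ & H)%rotating_inj. nra.
- intros ->. f_equal; ring.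
Qed.

(** Both sides of the biharmonic equation are multiples of m. *)
Lemma helix_biharmonic (s : R) : itv lo hi s ->
  cov3 tau T (cov3 tau T (cov3 tau T T)) s = riem tau (T s) (cov3 tau T T s) (T s) <->
  lam * (lam ^ 2 - 2 * tau * c * lam + 4 * (1 + tau ^ 2) * sg ^ 2) = 0.
Proof.
intros Hs.
(* [mu] is the covariant rotation speed of the plane spanned by n and m. *)
set (mu := lam - tau * c).
assert (Emu : b + (tau + 2 / tau) * c = mu) by (unfold mu, lam; field; lra).
assert (A := helix_acceleration).
assert (J : forall t, itv lo hi t -> cov3 tau T (cov3 tau T T) t
  = rotating (beta t) (- tau * sg * (sg * lam)) (- mu * (sg * lam)) 0).
{ intros t It. rewrite (cov3_rotating lo hi tau T _ beta b c sg 0 0 (sg * lam) t); auto.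
  rewrite Emu. f_equal; ring. }
assert (K : cov3 tau T (cov3 tau T (cov3 tau T T)) s
  = rotating (beta s) 0 0 (- (mu ^ 2 + tau ^ 2 * sg ^ 2) * (sg * lam))).
{ rewrite (cov3_rotating lo hi tau T _ beta b c sg
    (- tau * sg * (sg * lam)) (- mu * (sg * lam)) 0 s); auto.
  rewrite Emu. f_equal; ring. }
assert (Rm : riem tau (T s) (cov3 tau T T s) (T s)
  = rotating (beta s) 0 0 ((4 * (1 + tau ^ 2) * sg ^ 2 - tau ^ 2) * (sg * lam))).
{ rewrite riem_eq, A, helix by assumption.
  assert (S := sin2_cos2 (beta s)). unfold Rsqr in S.
  rewrite cross_of_cross.
  replace (dot (rotating (beta s) c sg 0) (rotating (beta s) c sg 0)) with 1.
  - replace (dot (rotating (beta s) 0 0 (sg * lam)) (rotating (beta s) c sg 0)) with 0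
      by (unfold rotating; vec_unfold; ring).
    replace (v1 (cross (rotating (beta s) c sg 0) (rotating (beta s) 0 0 (sg * lam))))
      with (- sg * (sg * lam)).
    + unfold rotating. apply vec_ext; vec_unfold; ring.
    + unfold rotating; vec_unfold.
      rewrite <- (Rmult_1_r (- sg * (sg * lam))), <- S. ring.
  - rewrite <- unit. unfold rotating; vec_unfold.
    rewrite <- (Rmult_1_r (sg ^ 2)), <- S. ring. }
rewrite K, Rm.
assert (P : (4 * (1 + tau ^ 2) * sg ^ 2 - tau ^ 2) * (sg * lam)
   - - (mu ^ 2 + tau ^ 2 * sg ^ 2) * (sg * lam)
   = sg * (lam * (lam ^ 2 - 2 * tau * c * lam + 4 * (1 + tau ^ 2) * sg ^ 2))).
{ unfold mu. replace (c ^ 2) with (1 - sg ^ 2) by lra.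
  transitivity (sg * lam * (4 * (1 + tau ^ 2) * sg ^ 2 - tau ^ 2 + lam ^ 2
    - 2 * tau * c * lam + tau ^ 2 * (c ^ 2 + sg ^ 2))); [ring|rewrite unit; ring]. }
split.
- intros (_ & _ & H)%rotating_inj. rewrite H, Rminus_diag in P.
  apply (Rmult_eq_reg_l sg); lra.
- intros H. rewrite H in P. f_equal. lra.
Qed.

End Helix.

Lemma polar_angle (x y : R) : x ^ 2 + y ^ 2 = 1 -> exists theta, x = sin theta /\ y = cos theta.
Proof.
intros H.
assert (B : -1 <= y <= 1) by nra.
assert (S : sin (acos y) = Rabs x).
{ rewrite sin_acos by assumption. rewrite <- sqrt_Rsqr_abs. f_equal. unfold Rsqr. nra. }
destruct (Rle_dec 0 x) as [P|N].
- exists (acos y). rewrite S, cos_acos, Rabs_pos_eq by assumption. auto.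
- exists (- acos y). rewrite sin_neg, cos_neg, S, cos_acos, Rabs_left by lra. split; ring.
Qed.

(** The coefficients of (f, h) in the frame rotating with speed b have zero
    derivative. *)
Lemma rotation_ode (lo hi : Rbar) (f h : R -> R) (b sg s0 : R) :
  0 < sg -> itv lo hi s0 -> f s0 ^ 2 + h s0 ^ 2 = sg ^ 2 ->
  (forall s, itv lo hi s -> is_derive f s (b * h s)) ->
  (forall s, itv lo hi s -> is_derive h s (- b * f s)) ->
  exists beta0, forall s, itv lo hi s ->
    f s = sg * sin (beta0 + b * (s - s0)) /\ h s = sg * cos (beta0 + b * (s - s0)).
Proof.
intros Hsg Hs0 H0 Df Dh.
destruct (polar_angle (f s0 / sg) (h s0 / sg)) as (beta0 & F0 & G0).
{ transitivity ((f s0 ^ 2 + h s0 ^ 2) / sg ^ 2); [field; lra|rewrite H0; field; lra]. }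
exists beta0. intros s Hs.
set (beta := fun t => beta0 + b * (t - s0)). change (beta0 + b * (s - s0)) with (beta s).
assert (B0 : beta s0 = beta0) by (unfold beta; ring).
assert (K : forall t, itv lo hi t ->
  is_derive (fun t => f t * cos (beta t) - h t * sin (beta t)) t 0 /\
  is_derive (fun t => f t * sin (beta t) + h t * cos (beta t)) t 0).
{ intros t It. assert (dF := Df t It). assert (dH := Dh t It).
  assert (ex_derive f t) by (eexists; exact dF).
  assert (ex_derive h t) by (eexists; exact dH).
  assert (Ef : Derive (fun x : R => f x) t = b * h t) by exact (is_derive_unique f t _ dF).
  assert (Eh : Derive (fun x : R => h x) t = - b * f t) by exact (is_derive_unique h t _ dH).
  unfold beta. split; auto_derive; auto; rewrite ?Ef, ?Eh; ring. }
assert (C1 := constant_on_itv lo hi _ (fun t It => proj1 (K t It)) s s0 Hs Hs0).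
assert (C2 := constant_on_itv lo hi _ (fun t It => proj2 (K t It)) s s0 Hs Hs0).
cbv beta in C1, C2. rewrite B0, <- F0, <- G0 in C1, C2.
replace (f s0 * (h s0 / sg) - h s0 * (f s0 / sg)) with 0 in C1 by (field; lra).
replace (f s0 * (f s0 / sg) + h s0 * (h s0 / sg)) with sg in C2.
2:{ transitivity ((f s0 ^ 2 + h s0 ^ 2) / sg); [rewrite H0; field; lra|field; lra]. }
assert (S := sin2_cos2 (beta s)). unfold Rsqr in S.
split.
- transitivity ((f s * sin (beta s) + h s * cos (beta s)) * sin (beta s)
    + (f s * cos (beta s) - h s * sin (beta s)) * cos (beta s)).
  + rewrite <- (Rmult_1_r (f s)) at 1. rewrite <- S. ring.
  + rewrite C1, C2. ring.
- transitivity ((f s * sin (beta s) + h s * cos (beta s)) * cos (beta s)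
    - (f s * cos (beta s) - h s * sin (beta s)) * sin (beta s)).
  + rewrite <- (Rmult_1_r (h s)) at 1. rewrite <- S. ring.
  + rewrite C1, C2. ring.
Qed.

(** As A is orthogonal to T and to e_1, it equals lambda (0, T_3, - T_2);
    lambda^2 is a positive constant, so the smooth function lambda is constant
    and (T_2, T_3) satisfies a rotation equation with constant speed. *)
Lemma biharmonic3_is_helix (tau : R) (lo hi : Rbar) (T : R -> vec) (s0 : R) :
  0 < tau -> smooth3 lo hi T -> (forall s, itv lo hi s -> dot (T s) (T s) = 1) ->
  biharmonic3 tau lo hi T -> itv lo hi s0 -> ~ geodesic3 tau lo hi T ->
  exists c sg b beta0, 0 < sg /\ c ^ 2 + sg ^ 2 = 1 /\
    forall s, itv lo hi s -> T s = rotating (beta0 + b * (s - s0)) c sg 0.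
Proof.
intros Ht ST unit bih Hs0 ngeo.
destruct (biharmonic3_curvature tau lo hi T s0) as (k & Hk & frenet); auto.
assert (A1 := biharmonic3_constant_angle tau lo hi T s0 Ht ST unit bih Hs0 ngeo).
set (A := cov3 tau T T) in *.
assert (SA : smooth3 lo hi A) by now apply smooth_cov3.
set (c := v1 (T s0)).
assert (T1 : forall s, itv lo hi s -> v1 (T s) = c).
{ intros s Hs. apply (constant_on_itv lo hi (fun t => v1 (T t))); auto.
  intros t It. assert (D := is_derive_v1 lo hi tau T T t ST It). fold A in D.
  rewrite A1 in D by assumption.
  replace 0 with (0 - v1 (conn tau (T t) (T t))) by (vec_unfold; ring). exact D. }
assert (N : forall s, itv lo hi s -> v2 (T s) ^ 2 + v3 (T s) ^ 2 = 1 - c ^ 2).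
{ intros s Hs. assert (U := unit s Hs). unfold dot in U. rewrite T1 in U by assumption. lra. }
assert (Hc : 0 < 1 - c ^ 2).
{ assert (Q := N s0 Hs0).
  destruct (Rle_lt_or_eq_dec 0 (1 - c ^ 2)) as [|Z]; [nra|assumption|].
  exfalso. apply ngeo. intros s Hs.
  assert (E : forall t, itv lo hi t -> T t = Vec c 0 0).
  { intros t It. assert (P := N t It). apply vec_ext; cbn; [auto|nra|nra]. }
  rewrite (cov3_ext lo hi tau T T _ s E Hs). unfold cov3, ddt. rewrite E by assumption.
  cbn. rewrite !Derive_const. vec_ring. }
set (sg := sqrt (1 - c ^ 2)).
assert (Hsg : 0 < sg) by now apply sqrt_lt_R0.
assert (Hsg2 : sg ^ 2 = 1 - c ^ 2) by (unfold sg; rewrite pow2_sqrt; lra).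
rewrite <- Hsg2 in N.
set (lam := fun s => / sg ^ 2 * (v2 (A s) * v3 (T s) - v3 (A s) * v2 (T s))).
assert (A23 : forall s, itv lo hi s -> v2 (A s) = lam s * v3 (T s) /\ v3 (A s) = - lam s * v2 (T s)).
{ intros s Hs. destruct (frenet s Hs) as (TA & _).
  unfold dot in TA. rewrite A1, Rmult_0_r in TA by assumption.
  assert (TA' : v2 (T s) * v2 (A s) = - (v3 (T s) * v3 (A s))) by lra.
  split; unfold lam; apply (Rmult_eq_reg_l (sg ^ 2)); try nra.
  - transitivity (v3 (T s) * v3 (T s) * v2 (A s) - v2 (T s) * (v3 (T s) * v3 (A s))).
    + rewrite <- (N s Hs).
      transitivity (v3 (T s) * v3 (T s) * v2 (A s) + v2 (T s) * (v2 (T s) * v2 (A s))); [ring|].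
      rewrite TA'. ring.
    + field. lra.
  - transitivity (v2 (T s) * v2 (T s) * v3 (A s) - v3 (T s) * (v2 (T s) * v2 (A s))).
    + rewrite <- (N s Hs). rewrite TA'. ring.
    + field. lra. }
assert (Slam : smooth_on lo hi lam).
{ destruct ST as (? & ? & ?), SA as (? & ? & ?). unfold lam. smooth_on_tac. }
assert (lam2 : forall s, itv lo hi s -> lam s ^ 2 = k / sg ^ 2).
{ intros s Hs. destruct (frenet s Hs) as (_ & AA & _). destruct (A23 s Hs) as (E2 & E3).
  unfold dot in AA. rewrite A1, E2, E3 in AA by assumption. rewrite <- AA, <- (N s Hs).
  field. rewrite (N s Hs). nra. }
assert (lamc : forall s, itv lo hi s -> lam s = lam s0).
{ intros s Hs. apply (constant_on_itv lo hi lam); auto.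
  intros t It.
  assert (D : is_derive lam t (Derive lam t))
    by (apply Derive_correct; now apply (smooth_on_ex_derive lo hi)).
  assert (D2 := is_derive_mult lam lam t _ _ D D Rmult_comm).
  apply (is_derive_const_on lo hi _ (k / sg ^ 2)) in D2; auto.
  - unfold plus, mult in D2; cbn in D2.
    assert (P : 0 < lam t ^ 2).
    { rewrite lam2 by assumption. apply Rdiv_lt_0_compat; nra. }
    assert (Z : Derive lam t = 0) by (apply (Rmult_eq_reg_l (lam t)); nra).
    now rewrite <- Z.
  - intros u Iu. rewrite <- (lam2 u Iu). unfold mult; cbn; ring. }
set (b := lam s0 - 2 * (tau + / tau) * c).
assert (D23 : forall s, itv lo hi s ->
  is_derive (fun t => v2 (T t)) s (b * v3 (T s)) /\
  is_derive (fun t => v3 (T t)) s (- b * v2 (T s))).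
{ intros s Hs. destruct (A23 s Hs) as (E2 & E3). rewrite lamc in E2, E3 by assumption.
  unfold A, cov3, ddt in E2, E3. revert E2 E3. vec_unfold. rewrite T1 by assumption. intros E2 E3.
  destruct ST as (S1 & S2 & S3). split.
  - replace (b * v3 (T s)) with (Derive (fun t => v2 (T t)) s).
    + apply Derive_correct. ex_derive_tac.
    + unfold b.
      replace (Derive (fun t => v2 (T t)) s) with (lam s0 * v3 (T s)
       - ((tau + 2 / tau) * c * v3 (T s) + tau * v3 (T s) * c)) by lra. field. lra.
  - replace (- b * v2 (T s)) with (Derive (fun t => v3 (T t)) s).
    + apply Derive_correct. ex_derive_tac.
    + unfold b.
      replace (Derive (fun t => v3 (T t)) s) with (- lam s0 * v2 (T s)
       - (- (tau + 2 / tau) * c * v2 (T s) - tau * v2 (T s) * c)) by lra. field. lra. }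
destruct (rotation_ode lo hi (fun t => v2 (T t)) (fun t => v3 (T t)) b sg s0)
  as (beta0 & E); auto; try (intros; now apply D23).
exists c, sg, b, beta0. split; [assumption|]. split; [lra|].
intros s Hs. destruct (E s Hs) as (E2 & E3).
unfold rotating. apply vec_ext; cbn [v1 v2 v3]; [auto|rewrite E2; ring|rewrite E3; ring].
Qed.

(** * Curves in SL2 and their coefficient functions *)

Lemma smooth_on_ip (lo hi : Rbar) (V W : R -> R42) :
  smooth_curve lo hi V -> smooth_curve lo hi W -> smooth_on lo hi (fun t => ip (V t) (W t)).
Proof.
intros (? & ? & ? & ?) (? & ? & ? & ?). unfold ip. smooth_on_tac.
Qed.

Lemma X1_eq (p : R42) : X1 p = ((- x2 p, x1 p), (- x4 p, x3 p)).
Proof. destruct p as [[p1 p2] [p3 p4]]. apply R42_ext; expand; ring. Qed.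
Lemma X2_eq (p : R42) : X2 p = ((x4 p, x3 p), (x2 p, x1 p)).
Proof. destruct p as [[p1 p2] [p3 p4]]. apply R42_ext; expand; ring. Qed.
Lemma X3_eq (p : R42) : X3 p = ((x3 p, - x4 p), (x1 p, - x2 p)).
Proof. destruct p as [[p1 p2] [p3 p4]]. apply R42_ext; expand; ring. Qed.

Lemma g_frame (tau : R) (p : R42) (u v : vec) : 0 < tau -> SL2 p ->
  g tau p (frame tau u p) (frame tau v p) = dot u v.
Proof.
intros Ht Hp.
destruct (frame_coeffs tau p u Ht Hp) as (U1 & U2 & U3 & U4).
destruct (frame_coeffs tau p v Ht Hp) as (V1 & V2 & V3 & V4).
rewrite g_comb by assumption. unfold dot. rewrite <- U1, <- U2, <- U3, <- V1, <- V2, <- V3.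
ring.
Qed.

Section Curve.
Context (tau : R) (nabla : field -> field -> field) (lo hi : Rbar) (gamma : R -> R42)
  (tau_pos : 0 < tau) (nabla_lc : levi_civita tau nabla)
  (gamma_smooth : smooth_curve lo hi gamma)
  (gamma_SL2 : forall s, itv lo hi s -> SL2 (gamma s)).

Definition velocity_coord (s : R) : vec := coord tau (gamma s) (velocity gamma s).
Local Notation T := velocity_coord.

Lemma smooth_velocity : smooth_curve lo hi (velocity gamma).
Proof.
destruct gamma_smooth as (S1 & S2 & S3 & S4).
split; [|split; [|split]];
  [apply smooth_on_Derive in S1; exact S1|apply smooth_on_Derive in S2; exact S2
  |apply smooth_on_Derive in S3; exact S3|apply smooth_on_Derive in S4; exact S4].
Qed.

(** Differentiate <gamma, gamma> = 1. *)
Lemma velocity_tangent (s : R) : itv lo hi s -> ip (velocity gamma s) (gamma s) = 0.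
Proof.
intros Hs. destruct gamma_smooth as (S1 & S2 & S3 & S4).
assert (E := Derive_ext_itv lo hi (fun t => ip (gamma t) (gamma t)) (fun _ => 1) s gamma_SL2 Hs).
rewrite Derive_const in E. unfold ip in E.
rewrite !Derive_minus, !Derive_plus, !Derive_mult in E by ex_derive_tac.
apply (Rmult_eq_reg_l 2); [|lra]. rewrite Rmult_0_r, <- E.
unfold ip.
change (x1 (velocity gamma s)) with (Derive (fun t => x1 (gamma t)) s).
change (x2 (velocity gamma s)) with (Derive (fun t => x2 (gamma t)) s).
change (x3 (velocity gamma s)) with (Derive (fun t => x3 (gamma t)) s).
change (x4 (velocity gamma s)) with (Derive (fun t => x4 (gamma t)) s).
ring.
Qed.

Lemma velocity_frame (s : R) : itv lo hi s -> velocity gamma s = frame tau (T s) (gamma s).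
Proof.
intros Hs. symmetry. apply frame_coord; auto using velocity_tangent.
Qed.

Lemma smooth_velocity_coord : smooth3 lo hi T.
Proof.
assert (SV := smooth_velocity).
assert (SX : smooth_curve lo hi (fun t => X1 (gamma t)) /\
  smooth_curve lo hi (fun t => X2 (gamma t)) /\ smooth_curve lo hi (fun t => X3 (gamma t))).
{ destruct gamma_smooth as (S1 & S2 & S3 & S4).
  assert (N := smooth_on_opp lo hi).
  repeat split;
   (eapply smooth_on_ext;
     [intros t _; symmetry; rewrite ?X1_eq, ?X2_eq, ?X3_eq; reflexivity|]);
   cbn; auto. }
destruct SX as (SX1 & SX2 & SX3).
assert (E : forall t, itv lo hi t -> Vec (- tau * ip (velocity gamma t) (X1 (gamma t)))
   (- ip (velocity gamma t) (X2 (gamma t))) (- ip (velocity gamma t) (X3 (gamma t))) = T t).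
{ intros t It. symmetry. apply coord_eq; auto. }
repeat split.
- apply (smooth_on_ext lo hi (fun t => - tau * ip (velocity gamma t) (X1 (gamma t)))).
  + intros t It. now rewrite <- E.
  + apply (smooth_on_mult lo hi (fun _ => - tau)); auto using smooth_on_const, smooth_on_ip.
- apply (smooth_on_ext lo hi (fun t => - ip (velocity gamma t) (X2 (gamma t)))).
  + intros t It. now rewrite <- E.
  + auto using smooth_on_opp, smooth_on_ip.
- apply (smooth_on_ext lo hi (fun t => - ip (velocity gamma t) (X3 (gamma t)))).
  + intros t It. now rewrite <- E.
  + auto using smooth_on_opp, smooth_on_ip.
Qed.

Lemma cov_frame (V : R -> R42) (v : R -> vec) (s : R) :
  (forall t, itv lo hi t -> V t = frame tau (v t) (gamma t)) -> itv lo hi s ->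
  cov tau nabla gamma V s = frame tau (cov3 tau T v s) (gamma s).
Proof.
intros E Hs.
assert (C : forall t, itv lo hi t -> coord tau (gamma t) (V t) = v t)
  by (intros t It; rewrite E by assumption; apply coord_frame; auto).
assert (C1 := fun t It => f_equal v1 (C t It)).
assert (C2 := fun t It => f_equal v2 (C t It)).
assert (C3 := fun t It => f_equal v3 (C t It)).
cbn [coord v1 v2 v3] in C1, C2, C3.
assert (N : forall (F : field) u, vector_field F -> (forall q, F q = frame tau u q) ->
  nabla (frame_ext tau (gamma s) (velocity gamma s)) F (gamma s)
  = frame tau (conn tau (T s) u) (gamma s)).
{ intros F u VF EF. apply nabla_frame; auto. now apply (vector_field_frame tau (T s)). }
unfold cov.
rewrite (N (E1 tau) (Vec 1 0 0)), (N E2 (Vec 0 1 0)), (N E3 (Vec 0 0 1));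
  auto using vector_field_E1, vector_field_E2, vector_field_E3;
  try (intros q; unfold frame; apply R42_ext; coords; cbn [v1 v2 v3]; ring).
rewrite (Derive_ext_itv lo hi _ _ s C1 Hs), (Derive_ext_itv lo hi _ _ s C2 Hs),
  (Derive_ext_itv lo hi _ _ s C3 Hs), (C1 s Hs), (C2 s Hs), (C3 s Hs).
unfold frame. apply R42_ext; coords; unfold cov3, ddt; vec_unfold; ring.
Qed.

Lemma geodesic_coord : geodesic tau nabla lo hi gamma <-> geodesic3 tau lo hi T.
Proof.
split; intros H s Hs; assert (Q := H s Hs); cbv beta in Q.
- rewrite (cov_frame _ T s velocity_frame Hs) in Q.
  apply frame_eq_zero in Q; auto.
- rewrite (cov_frame _ T s velocity_frame Hs), Q. apply frame_eq_zero; auto.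
Qed.

Lemma bitension_frame (s : R) : itv lo hi s ->
  bitension tau nabla gamma s
  = frame tau (sub3 (cov3 tau T (cov3 tau T (cov3 tau T T)) s)
                    (riem tau (T s) (cov3 tau T T s) (T s))) (gamma s).
Proof.
intros Hs. unfold bitension.
assert (D1 := fun t => cov_frame _ T t velocity_frame).
assert (D2 := fun t => cov_frame _ _ t D1).
assert (D3 := cov_frame _ _ s D2 Hs).
rewrite D3, curvature_coord by auto.
rewrite (D1 s Hs), coord_frame by auto. apply frame_sub.
Qed.

Lemma biharmonic_coord : biharmonic tau nabla lo hi gamma <-> biharmonic3 tau lo hi T.
Proof.
assert (Z : forall u v, sub3 u v = Vec 0 0 0 <-> u = v).
{ intros u v. split; [|intros ->; vec_ring].
  destruct u, v; unfold sub3; cbn. intros [= ? ? ?]. f_equal; lra. }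
split; intros H s Hs; assert (Q := H s Hs).
- rewrite (bitension_frame s Hs) in Q.
  apply frame_eq_zero in Q; auto. now apply (proj1 (Z _ _)).
- rewrite (bitension_frame s Hs). apply frame_eq_zero; auto. now apply (proj2 (Z _ _)).
Qed.

End Curve.

(** In complex notation z = f + i h the hypotheses say z'' = a z + i b z'.
    Differentiating twice and substituting eliminates i b z'. *)
Lemma fourth_order_ode (lo hi : Rbar) (a b : R) (f h : R -> R) :
  smooth_on lo hi f -> smooth_on lo hi h ->
  (forall s, itv lo hi s -> Derive_n f 2 s = a * f s - b * Derive h s) ->
  (forall s, itv lo hi s -> Derive_n h 2 s = a * h s + b * Derive f s) ->
  forall s, itv lo hi s ->
    Derive_n f 4 s + (b ^ 2 - 2 * a) * Derive_n f 2 s + a ^ 2 * f s = 0.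
Proof.
intros Sf Sh F2 H2.
assert (lin : forall (k u v : R -> R) (c d s : R), smooth_on lo hi u -> smooth_on lo hi v ->
  (forall t, itv lo hi t -> k t = c * u t + d * v t) -> itv lo hi s ->
  Derive k s = c * Derive u s + d * Derive v s).
{ intros k u v c d s Su Sv E Hs. rewrite (Derive_ext_itv lo hi k _ s E Hs).
  rewrite Derive_plus, !Derive_scal by ex_derive_tac. reflexivity. }
assert (F3 : forall s, itv lo hi s -> Derive_n f 3 s = a * Derive f s + (- b) * Derive_n h 2 s).
{ intros s Hs. apply (lin (Derive_n f 2) f (Derive h)); auto using smooth_on_Derive.
  intros t It. rewrite F2 by assumption. ring. }
assert (H3 : forall s, itv lo hi s -> Derive_n h 3 s = a * Derive h s + b * Derive_n f 2 s).
{ intros s Hs. apply (lin (Derive_n h 2) h (Derive f)); auto using smooth_on_Derive. }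
intros s Hs.
assert (F4 : Derive_n f 4 s = a * Derive_n f 2 s + (- b) * Derive_n h 3 s).
{ apply (lin (Derive_n f 3) (Derive f) (Derive_n h 2)); auto using smooth_on_Derive.
  apply (smooth_on_Derive lo hi (Derive h)). now apply smooth_on_Derive. }
rewrite F4, H3 by assumption.
assert (E := F2 s Hs).
transitivity (- a * (Derive_n f 2 s - (a * f s - b * Derive h s))); [ring|rewrite E; ring].
Qed.

(** The velocity equation of a helix, written with z = f + i h and y = u + i v:
    z' = - i (c / tau) z + sg e^(i beta) conj(y), and the same with z and y exchanged.
    Differentiating, e^(i beta) conj(y)' contributes sg^2 z, the terms
    in c recombine and beta' = b gives i b z' up to a multiple of z:
    z'' = a z + i b z'. *)
Lemma twisted_system_second_order (lo hi : Rbar) (tau c sg b : R) (beta f h u v : R -> R) :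
  0 < tau ->
  (forall s, itv lo hi s -> is_derive beta s b) ->
  (forall s, itv lo hi s ->
    is_derive f s (c / tau * h s + sg * (cos (beta s) * u s + sin (beta s) * v s)) /\
    is_derive h s (- c / tau * f s + sg * (sin (beta s) * u s - cos (beta s) * v s))) ->
  (forall s, itv lo hi s ->
    is_derive u s (c / tau * v s + sg * (cos (beta s) * f s + sin (beta s) * h s)) /\
    is_derive v s (- c / tau * u s + sg * (sin (beta s) * f s - cos (beta s) * h s))) ->
  let a := sg ^ 2 - c ^ 2 / tau ^ 2 - b * c / tau in
  forall s, itv lo hi s ->
    Derive_n f 2 s = a * f s - b * Derive h s /\ Derive_n h 2 s = a * h s + b * Derive f s.
Proof.
intros Ht Hb Hfh Huv a s Hs.
destruct (Hfh s Hs) as (Df & Dh), (Huv s Hs) as (Du & Dv). assert (Db := Hb s Hs).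
assert (ex_derive f s) by (eexists; exact Df).
assert (ex_derive h s) by (eexists; exact Dh).
assert (ex_derive u s) by (eexists; exact Du).
assert (ex_derive v s) by (eexists; exact Dv).
assert (ex_derive beta s) by (eexists; exact Db).
assert (Qf : Derive_n f 2 s = Derive (fun t =>
  c / tau * h t + sg * (cos (beta t) * u t + sin (beta t) * v t)) s).
{ apply (Derive_ext_itv lo hi); [|assumption].
  intros t It. apply is_derive_unique. apply (Hfh t It). }
assert (Qh : Derive_n h 2 s = Derive (fun t =>
  - c / tau * f t + sg * (sin (beta t) * u t - cos (beta t) * v t)) s).
{ apply (Derive_ext_itv lo hi); [|assumption].
  intros t It. apply is_derive_unique. apply (Hfh t It). }
apply is_derive_unique in Df, Dh, Du, Dv, Db.
rewrite Qf, Qh, Df, Dh.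
set (df := c / tau * h s + _) in *. set (dh := - c / tau * f s + _) in *.
set (du := c / tau * v s + _) in *. set (dv := - c / tau * u s + _) in *.
change (Derive (fun x : R => f x) s = df) in Df.
change (Derive (fun x : R => h x) s = dh) in Dh.
change (Derive (fun x : R => u x) s = du) in Du.
change (Derive (fun x : R => v x) s = dv) in Dv.
change (Derive (fun x : R => beta x) s = b) in Db.
assert (Tr := sin2_cos2 (beta s)). unfold Rsqr in Tr.
(* Proving [l = r] reduces to a ring identity modulo sin^2 + cos^2 = 1; the
   only place where that relation enters is the term sg^2 x. *)
assert (mod_unit : forall l r x, l - r = sg ^ 2 * x *
    (sin (beta s) * sin (beta s) + cos (beta s) * cos (beta s) - 1) -> l = r)
  by (intros l r x Q; rewrite Tr in Q; lra).
split; apply is_derive_unique; (auto_derive; [repeat split; assumption|]);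
  rewrite ?Df, ?Dh, ?Du, ?Dv, ?Db; unfold a, df, dh, du, dv;
  [apply (mod_unit _ _ (f s))|apply (mod_unit _ _ (h s))]; field; lra.
Qed.

(** * The ambient equation and the admissible slopes *)

Lemma frame_eq (tau : R) (u : vec) (p : R42) :
  frame tau u p =
    ((/ tau * v1 u * x2 p + v2 u * x4 p + v3 u * x3 p,
      - / tau * v1 u * x1 p + v2 u * x3 p - v3 u * x4 p),
     (/ tau * v1 u * x4 p + v2 u * x2 p + v3 u * x1 p,
      - / tau * v1 u * x3 p + v2 u * x1 p - v3 u * x2 p)).
Proof.
unfold frame, E1, E2, E3. rewrite X1_eq, X2_eq, X3_eq.
apply R42_ext; coords; unfold x1, x2, x3, x4, Re, Im; cbn [fst snd]; ring.
Qed.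

(** Both (x1, x2) and (x3, x4) satisfy the twisted system, with the roles of
    the two pairs exchanged; the second member of a pair follows from the first
    by changing the sign of b with a kept fixed, and the fourth-order equation
    then contains b only through b^2. *)
Lemma helix_fourth_order_ode (lo hi : Rbar) (gamma : R -> R42) (beta : R -> R)
  (tau c sg b : R) : 0 < tau -> smooth_curve lo hi gamma ->
  (forall s, itv lo hi s -> is_derive beta s b) ->
  (forall s, itv lo hi s -> velocity gamma s = frame tau (rotating (beta s) c sg 0) (gamma s)) ->
  let a := sg ^ 2 - c ^ 2 / tau ^ 2 - b * c / tau in
  forall s, itv lo hi s ->
    vDerive_n gamma 4 s +v (b ^ 2 - 2 * a) *v vDerive_n gamma 2 s +v a ^ 2 *v gamma s = vzero.
Proof.
intros Ht (S1 & S2 & S3 & S4) Hb Hv a.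
set (f1 := fun t => x1 (gamma t)) in *. set (f2 := fun t => x2 (gamma t)) in *.
set (f3 := fun t => x3 (gamma t)) in *. set (f4 := fun t => x4 (gamma t)) in *.
assert (correct : forall f s l, smooth_on lo hi f -> itv lo hi s -> Derive f s = l -> is_derive f s l).
{ intros f s l Sf Hs <-. apply Derive_correct. now apply (smooth_on_ex_derive lo hi). }
assert (D : forall s, itv lo hi s ->
  (is_derive f1 s (c / tau * f2 s + sg * (cos (beta s) * f3 s + sin (beta s) * f4 s)) /\
   is_derive f2 s (- c / tau * f1 s + sg * (sin (beta s) * f3 s - cos (beta s) * f4 s))) /\
  (is_derive f3 s (c / tau * f4 s + sg * (cos (beta s) * f1 s + sin (beta s) * f2 s)) /\
   is_derive f4 s (- c / tau * f3 s + sg * (sin (beta s) * f1 s - cos (beta s) * f2 s)))).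
{ intros s Hs. assert (V := Hv s Hs). rewrite frame_eq in V. unfold rotating in V. cbn [v1 v2 v3] in V.
  unfold velocity, vDerive_n in V. injection V as V1 V2 V3 V4.
  split; split; apply correct; auto;
    [etransitivity; [exact V1|]|etransitivity; [exact V2|]
    |etransitivity; [exact V3|]|etransitivity; [exact V4|]];
    unfold f1, f2, f3, f4; field; lra. }
assert (Q12 := twisted_system_second_order lo hi tau c sg b beta f1 f2 f3 f4 Ht Hb
  (fun s Hs => proj1 (D s Hs)) (fun s Hs => proj2 (D s Hs))).
assert (Q34 := twisted_system_second_order lo hi tau c sg b beta f3 f4 f1 f2 Ht Hb
  (fun s Hs => proj2 (D s Hs)) (fun s Hs => proj1 (D s Hs))).
cbv zeta in Q12, Q34. fold a in Q12, Q34.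
assert (ode : forall f h, smooth_on lo hi f -> smooth_on lo hi h ->
  (forall s, itv lo hi s ->
     Derive_n f 2 s = a * f s - b * Derive h s /\ Derive_n h 2 s = a * h s + b * Derive f s) ->
  forall s, itv lo hi s ->
    Derive_n f 4 s + (b ^ 2 - 2 * a) * Derive_n f 2 s + a ^ 2 * f s = 0 /\
    Derive_n h 4 s + (b ^ 2 - 2 * a) * Derive_n h 2 s + a ^ 2 * h s = 0).
{ intros f h Sf Sh H s Hs. split.
  - apply (fourth_order_ode lo hi a b f h); auto; intros; now apply H.
  - replace (b ^ 2) with ((- b) ^ 2) by ring.
    apply (fourth_order_ode lo hi a (- b) h f); auto; intros t It;
      destruct (H t It) as (E1 & E2); [rewrite E2|rewrite E1]; ring. }
intros s Hs.
destruct (ode f1 f2 S1 S2 Q12 s Hs) as (O1 & O2).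
destruct (ode f3 f4 S3 S4 Q34 s Hs) as (O3 & O4).
apply R42_ext; [exact O1|exact O2|exact O3|exact O4].
Qed.

Lemma smooth_on_affine (lo hi : Rbar) (x b s0 : R) :
  smooth_on lo hi (fun s => x + b * (s - s0)).
Proof.
assert (S : smooth_on lo hi (fun s => s)).
{ intros [|[|n]] s _; [exact I|apply ex_derive_id|].
  apply (ex_derive_ext (Derive_n (fun _ => 1) n)).
  - intros t. rewrite <- Derive_n_Derive. apply Derive_n_ext. intros u. symmetry. apply Derive_id.
  - exact (ex_derive_n_const 1 (S n) s). }
smooth_on_tac.
Qed.

Lemma cos_angle (c sg : R) : 0 <= c -> 0 < sg -> c ^ 2 + sg ^ 2 = 1 ->
  exists theta, 0 < theta <= PI / 2 /\ cos theta = c /\ sin theta = sg.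
Proof.
intros Hc Hsg E.
assert (B : -1 <= c <= 1) by nra.
exists (acos c).
assert (C := cos_acos c B).
assert (S : sin (acos c) = sg).
{ rewrite sin_acos by assumption. replace (1 - Rsqr c) with (sg ^ 2) by (unfold Rsqr; lra).
  apply sqrt_pow2. lra. }
repeat split; auto.
- destruct (acos_bound c) as [[L|L] _]; [assumption|].
  exfalso. rewrite <- L, sin_0 in S. lra.
- destruct (Rle_lt_dec (acos c) (PI / 2)) as [|G]; [assumption|].
  exfalso. assert (P := acos_bound c). assert (N := cos_lt_0 (acos c)). lra.
Qed.

(** Completing the square: the quadratic is (lam - tau c)^2 - disc, and
    lam - tau c is b + (2 + tau^2) c / tau. *)
Lemma quadratic_roots (tau c sg b lam : R) : 0 < tau -> c ^ 2 + sg ^ 2 = 1 ->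
  lam = b + 2 * (tau + / tau) * c ->
  let disc := (4 + 5 * tau ^ 2) * c ^ 2 - 4 * (1 + tau ^ 2) in
  lam ^ 2 - 2 * tau * c * lam + 4 * (1 + tau ^ 2) * sg ^ 2 = 0 <->
  0 <= disc /\ exists sgn, (sgn = 1 \/ sgn = -1) /\
    b = - / tau * (2 + tau ^ 2) * c + sgn * sqrt disc.
Proof.
intros Ht E Hlam disc.
assert (Sq : lam ^ 2 - 2 * tau * c * lam + 4 * (1 + tau ^ 2) * sg ^ 2 = (lam - tau * c) ^ 2 - disc).
{ unfold disc. replace (sg ^ 2) with (1 - c ^ 2) by lra. ring. }
assert (Hb : b = - / tau * (2 + tau ^ 2) * c + (lam - tau * c)) by (rewrite Hlam; field; lra).
rewrite Sq. split.
- intros H. assert (D : disc = (lam - tau * c) ^ 2) by lra.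
  split; [rewrite D; apply pow2_ge_0|].
  rewrite D. destruct (Rle_lt_dec 0 (lam - tau * c)) as [P|N].
  + exists 1. split; [auto|]. rewrite sqrt_pow2 by assumption. lra.
  + exists (-1). split; [auto|].
    replace ((lam - tau * c) ^ 2) with ((- (lam - tau * c)) ^ 2) by ring.
    rewrite sqrt_pow2 by lra. lra.
- intros (P & sgn & Hsgn & Hb').
  replace (lam - tau * c) with (sgn * sqrt disc) by lra.
  rewrite Rpow_mult_distr, pow2_sqrt by assumption.
  destruct Hsgn as [-> | ->]; ring.
Qed.

Theorem theorem3p4 (tau : R) (nabla : field -> field -> field)
  (lo hi : Rbar) (gamma : R -> R42)
  (tau_pos : 0 < tau)
  (nabla_lc : levi_civita tau nabla)
  (lo_lt_hi : Rbar_lt lo hi)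
  (gamma_smooth : smooth_curve lo hi gamma)
  (gamma_SL2 : forall s, itv lo hi s -> SL2 (gamma s))
  (gamma_unit : forall s, itv lo hi s ->
     g tau (gamma s) (velocity gamma s) (velocity gamma s) = 1)
  (gamma_direction : forall c : R,
     (forall s, itv lo hi s ->
        g tau (gamma s) (velocity gamma s) (E1 tau (gamma s)) = c) -> 0 <= c) :
  proper_biharmonic tau nabla lo hi gamma <->
  exists (theta : R) (beta : R -> R),
    0 < theta <= PI / 2 /\
    4 * (1 + tau ^ 2) / (4 + 5 * tau ^ 2) <= cos theta ^ 2 < 1 /\
    smooth_on lo hi beta /\
    (forall s, itv lo hi s ->
       velocity gamma s
       = cos theta *v E1 tau (gamma s)
         +v (sin theta * sin (beta s)) *v E2 (gamma s)
         +v (sin theta * cos (beta s)) *v E3 (gamma s)) /\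
    exists a b sgn : R,
      (sgn = 1 \/ sgn = -1) /\
      b = - / tau * (2 + tau ^ 2) * cos theta
          + sgn * sqrt ((4 + 5 * tau ^ 2) * cos theta ^ 2 - 4 * (1 + tau ^ 2)) /\
      (forall s, itv lo hi s ->
         Derive beta s = b /\
         a = 1 / 2 * (- / tau ^ 2 + 1 - (1 + / tau ^ 2) * cos (2 * theta))
             - / tau * cos theta * Derive beta s) /\
      (forall s, itv lo hi s ->
         vDerive_n gamma 4 s +v (b ^ 2 - 2 * a) *v vDerive_n gamma 2 s
         +v a ^ 2 *v gamma s = vzero).
Proof.
destruct (itv_inhabited lo hi lo_lt_hi) as (s0 & Hs0).
set (T := velocity_coord tau gamma).
assert (HT : forall s, itv lo hi s -> velocity gamma s = frame tau (T s) (gamma s))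
  by (intros; now apply (velocity_frame tau lo hi)).
assert (ST : smooth3 lo hi T) by (apply smooth_velocity_coord; assumption).
assert (unit : forall s, itv lo hi s -> dot (T s) (T s) = 1).
{ intros s Hs. rewrite <- (gamma_unit s Hs), HT by assumption. symmetry. apply g_frame; auto. }
assert (discriminant : forall c, 4 * (1 + tau ^ 2) / (4 + 5 * tau ^ 2) <= c ^ 2 <->
  0 <= (4 + 5 * tau ^ 2) * c ^ 2 - 4 * (1 + tau ^ 2)).
{ intros c. rewrite Rle_div_l by nra. lra. }
unfold proper_biharmonic.
rewrite (biharmonic_coord tau nabla lo hi gamma), (geodesic_coord tau nabla lo hi gamma)
  by assumption. fold T.
assert (combination : forall theta beta s,
  frame tau (rotating beta (cos theta) (sin theta) 0) (gamma s)
  = cos theta *v E1 tau (gamma s) +v (sin theta * sin beta) *v E2 (gamma s)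
    +v (sin theta * cos beta) *v E3 (gamma s)).
{ intros. unfold frame, rotating; cbn [v1 v2 v3]. apply R42_ext; coords; ring. }
split.
- intros (bih & ngeo).
  destruct (biharmonic3_is_helix tau lo hi T s0 tau_pos ST unit bih Hs0 ngeo)
    as (c & sg & b & beta0 & Hsg & Hcsg & helix).
  set (beta := fun s => beta0 + b * (s - s0)).
  assert (Dbeta : forall s, is_derive beta s b)
    by (intros s; unfold beta; auto_derive; [exact I|ring]).
  assert (Hc : 0 <= c).
  { apply gamma_direction. intros s Hs.
    change (v1 (T s) = c). now rewrite helix. }
  destruct (cos_angle c sg Hc Hsg Hcsg) as (theta & Htheta & Ecos & Esin).
  assert (bihs := proj1 (helix_biharmonic lo hi tau T beta b c sg tau_pos Hsg Hcsg helix
    (fun t _ => Dbeta t) s0 Hs0) (bih s0 Hs0)).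
  apply Rmult_integral in bihs as [Z|quad].
  { exfalso. apply ngeo. intros s Hs.
    now apply (helix_geodesic lo hi tau T beta b c sg tau_pos Hsg helix (fun t _ => Dbeta t)). }
  apply (quadratic_roots tau c sg b _ tau_pos Hcsg eq_refl) in quad
    as (Hdisc & sgn & Hsgn & Hb).
  assert (vel : forall s, itv lo hi s ->
    velocity gamma s = frame tau (rotating (beta s) c sg 0) (gamma s))
    by (intros s Hs; rewrite HT, helix by assumption; reflexivity).
  exists theta, beta. split; [assumption|].
  split; [rewrite Ecos; split; [now apply discriminant|nra]|].
  split; [apply smooth_on_affine|].
  split; [intros s Hs; rewrite <- combination, Ecos, Esin; auto|].
  exists (sg ^ 2 - c ^ 2 / tau ^ 2 - b * c / tau), b, sgn.
  rewrite Ecos. split; [assumption|]. split; [assumption|]. split.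
  + intros s Hs. rewrite (is_derive_unique _ _ _ (Dbeta s)). split; [reflexivity|].
    rewrite cos_2a_cos, Ecos. replace (sg ^ 2) with (1 - c ^ 2) by lra. field. lra.
  + apply (helix_fourth_order_ode lo hi gamma beta); auto.
- intros (theta & beta & Htheta & (Hcos & Hcos1) & Sbeta & vel & a & b & sgn & Hsgn & Hb & Hbeta & _).
  assert (Hsin : 0 < sin theta) by (apply sin_gt_0; lra).
  assert (Hcsg : cos theta ^ 2 + sin theta ^ 2 = 1).
  { rewrite <- (sin2_cos2 theta). unfold Rsqr. ring. }
  assert (Dbeta : forall s, itv lo hi s -> is_derive beta s b).
  { intros s Hs. rewrite <- (proj1 (Hbeta s Hs)). apply Derive_correct.
    now apply (smooth_on_ex_derive lo hi). }
  assert (helix : forall s, itv lo hi s -> T s = rotating (beta s) (cos theta) (sin theta) 0).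
  { intros s Hs. unfold T, velocity_coord. rewrite vel, <- combination by assumption.
    apply coord_frame; auto. }
  assert (quad := proj2 (quadratic_roots tau (cos theta) (sin theta) b _ tau_pos Hcsg eq_refl)
    (conj (proj1 (discriminant _) Hcos) (ex_intro _ sgn (conj Hsgn Hb)))).
  split.
  + intros s Hs. apply (helix_biharmonic lo hi tau T beta b (cos theta) (sin theta)); auto.
    rewrite quad. ring.
  + intros geo. assert (Z := geo s0 Hs0).
    apply (helix_geodesic lo hi tau T beta b (cos theta) (sin theta)) in Z; auto.
    rewrite Z in quad. assert (0 < sin theta ^ 2) by nra. nra.
Qed.
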